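(* Let $V$ be a vertex operator algebra containing a Heisenberg vertex operator subalgebra generated by a Heisenberg field $J$, with zero mode $J_0$. Suppose there are simple $V$-modules $A,B,C$ and $h\in\mathbb C$ such that $B\not\cong C$ and: (1) $J_0$ acts semisimply on $A,B,C$ and its eigenvalues on $A,B,C$ lie in $h+\mathbb Z$; (2) $\mathrm{Ext}^1(A,A)=\mathrm{Ext}^1(B,B)=\mathrm{Ext}^1(C,C)=0$; (3) there exist modules $E_B,F_C$ and non-split short exact sequences $0\to B\to E_B\to A\to0$ and $0\to A\to F_C\to C\to0$; (4) with $\pi=e^{-2\pi ih}\,\mathrm{Id}\,\exp(2\pi iJ_0)-\mathrm{Id}$, there exist modules $E_B^{(2)},F_C^{(2)}$ and non-split short exact sequences $0\to E_B\to E_B^{(2)}\xrightarrow{\ \pi\ }E_B\to0$ and $0\to F_C\to F_C^{(2)}\xrightarrow{\ \pi\ }F_C\to0$. Then there exists an indecomposable $V$-module $P_A$ on which $J_0$ acts semisimply and whose Loewy diagram has top layer $A$, middle layer $B\oplus C$ and bottom layer $A$, with (non-split) arrows from the top $A$ to $B$ and to $C$, and from $B$ and from $C$ to the bottom $A$.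
   Context: All modules are (generalized) $V$-modules in a category in which contragredient duals are defined and exact and reverse short exact sequences (modules graded by generalized eigenvalues with finite-dimensional graded pieces, so that $J_0$ and $L_0$ need not act semisimply). In (4), the notation means that the operator $\pi$ is a $V$-module endomorphism of $E_B^{(2)}$ (resp. $F_C^{(2)}$) whose kernel and image are both isomorphic to $E_B$ (resp. $F_C$), and the second map in the sequence is $\pi$ viewed as a map onto its image. A Loewy diagram displays the semisimple layers of a module (head on top, socle at the bottom), an arrow $X\to Y$ indicating a non-split subquotient with submodule $Y$ and quotient $X$. *)

(* Defs.v *)
From mathcomp Require Import all_boot all_order all_algebra.
From mathcomp Require Import complex.
From mathcomp Require Import all_classical all_reals all_analysis.

Set Implicit Arguments.
Unset Strict Implicit.
Unset Printing Implicit Defensive.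
Import GRing.Theory Num.Theory.
Local Open Scope classical_set_scope.
Local Open Scope complex_scope.
Local Open Scope ring_scope.

(* The complex numbers are R[i] for an arbitrary R : realType. *)

Section LinearAlgebra.
Variable R : realType.
Implicit Types M : lmodType R[i].

Definition cexp (z : R[i]) : R[i] :=
  (expR (complex.Re z))%:C * (cos (complex.Im z) +i* sin (complex.Im z)).

Definition two_pi_i : R[i] := 0 +i* (2 * pi).

Definition binz (m : int) (i : nat) : R[i] :=
  (\prod_(j < i) (m - j%:Z)%:~R) / (i`!)%:R.

(* (D - lam)^k *)
Definition shift_iter M (D : M -> M) (lam : R[i]) (k : nat) (v : M) : M :=
  iter k (fun x => D x - lam *: x) v.

Definition op_eigenspace M (D : M -> M) (lam : R[i]) : set M :=
  [set v | D v = lam *: v].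

Definition gen_eigenspace M (D : M -> M) (lam : R[i]) : set M :=
  [set v | exists N : nat, shift_iter D lam N v = 0].

(* Every vector is a finite sum of elements of Q.  When Q is a union of (joint
   generalized) eigenspaces, the sum of these eigenspaces is automatically
   direct, so this says that M is graded by them. *)
Definition sums_of M (Q : set M) : Prop :=
  forall v : M, exists s : seq M, {in s, forall x, Q x} /\ v = \sum_(x <- s) x.

Definition finite_dim M (E : set M) : Prop :=
  exists s : seq M, forall v, E v ->
    exists c : nat -> R[i], v = \sum_(i < size s) c i *: s`_i.

Definition semisimple_op M (D : M -> M) : Prop :=
  sums_of [set v | exists lam, op_eigenspace D lam v].

(* T = exp(D) for an operator D such that M is the sum of the generalized
   eigenspaces of D: if (D - lam)^N v = 0, the exponential series evaluated at
   v is e^lam times the finite sum of the (D - lam)^k v / k! for k < N. *)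
Definition is_opexp M (D T : M -> M) : Prop :=
  linear T /\
  forall (lam : R[i]) (N : nat) (v : M), shift_iter D lam N v = 0 ->
    T v = cexp lam *: \sum_(k < N) (k`!)%:R^-1 *: shift_iter D lam k v.

(* On such an M there is exactly one T with is_opexp D T, so the default value
   of xget plays no role. *)
Definition opexp M (D : M -> M) : M -> M := xget (fun=> 0) [set T | is_opexp D T].

End LinearAlgebra.

(* The Borcherds (Jacobi) identity for an action YM of V on M, in modes:
   sum_i C(m,i) (a_(n+i) b)_(m+k-i) u
     = sum_i (-1)^i C(n,i)
         (a_(m+n-i) b_(k+i) u - (-1)^n b_(n+k-i) a_(m+i) u).
   By lower truncation only finitely many terms are nonzero, so the identity is
   stated for all sufficiently long partial sums. *)
Definition borcherds (R : realType) (V M : lmodType R[i])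
    (Y : V -> int -> V -> V) (YM : V -> int -> M -> M) : Prop :=
  forall (a b : V) (u : M) (m n k : int),
  exists N0 : nat, forall N : nat, (N0 <= N)%N ->
    \sum_(i < N) binz R m i *: YM (Y a (n + i%:Z) b) (m + k - i%:Z) u =
    \sum_(i < N) ((-1) ^+ i * binz R n i) *:
      (YM a (m + n - i%:Z) (YM b (k + i%:Z) u)
       - (-1) ^+ `|n|%N *: YM b (n + k - i%:Z) (YM a (m + i%:Z) u)).

Definition lower_truncated (R : realType) (V M : lmodType R[i])
    (YM : V -> int -> M -> M) : Prop :=
  forall (a : V) (u : M),
    exists N : int, forall n : int, (N <= n)%R -> YM a n u = 0.

Definition bilinear_modes (R : realType) (V M : lmodType R[i])
    (YM : V -> int -> M -> M) : Prop :=
  (forall n u, linear (fun a => YM a n u)) /\ (forall a n, linear (YM a n)).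

Definition vacuum_acts (R : realType) (V M : lmodType R[i])
    (vac : V) (YM : V -> int -> M -> M) : Prop :=
  forall n u, YM vac n u = if n == - 1 then u else 0.

(* voa_mode a n b is the mode a_(n) b, where Y(a,z) = sum_n a_(n) z^(-n-1);
   accordingly L_n = omega_(n+1). *)
Record voa (R : realType) := VOA {
  voa_car :> lmodType R[i];
  voa_mode : voa_car -> int -> voa_car -> voa_car;
  voa_vac : voa_car;
  voa_omega : voa_car;
  voa_c : R[i];
  voa_bilinear : bilinear_modes voa_mode;
  voa_truncated : lower_truncated voa_mode;
  voa_vacuum : vacuum_acts voa_vac voa_mode;
  voa_creation : forall a n, (- 1 <= n)%R ->
    voa_mode a n voa_vac = if n == - 1 then a else 0;
  voa_borcherds : borcherds voa_mode voa_mode;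
  voa_virasoro : let L n := voa_mode voa_omega (n + 1) in
    forall (m n : int) v,
      L m (L n v) - L n (L m v) = (m - n)%:~R *: L (m + n) v +
        (if m + n == 0 then ((m ^+ 3 - m)%:~R / 12%:R * voa_c) *: v else 0);
  voa_derivative : forall a n b,
    voa_mode (voa_mode voa_omega 0 a) n b = - n%:~R *: voa_mode a (n - 1) b;
  voa_graded :
    sums_of [set v | exists n : int,
                       op_eigenspace (voa_mode voa_omega 1) n%:~R v];
  voa_finite : forall n : int,
    finite_dim (op_eigenspace (voa_mode voa_omega 1) n%:~R);
  voa_bounded : exists N : int, forall n : int, (n < N)%R ->
    op_eigenspace (voa_mode voa_omega 1) n%:~R `<=` [set 0]
}.

(* J is a Heisenberg field of nonzero level k: it has conformal weight 1 and
   J(z)J(w) ~ k (z-w)^(-2). *)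
Definition heisenberg (R : realType) (V : voa R) (J : V) : Prop :=
  [/\ voa_vac V != 0,
      voa_mode (voa_omega V) 1 J = J &
      exists2 k : R[i], k != 0 &
        forall n : nat,
          voa_mode J n%:Z J = if n == 1%N then k *: voa_vac V else 0].

(* A space with operators u |-> a_(n) u, not yet subject to any axiom. *)
Record mode_space (R : realType) (V : voa R) := ModeSpace {
  ms_car :> lmodType R[i];
  act : V -> int -> ms_car -> ms_car
}.
Arguments act {R V} m a n u.

Definition J0 (R : realType) (V : voa R) (J : V) (M : mode_space V) : M -> M :=
  act M J 0.

Definition L0 (R : realType) (V : voa R) (M : mode_space V) : M -> M :=
  act M (voa_omega V) 1.
Arguments L0 {R V} M.

Definition joint_space (R : realType) (V : voa R) (J : V) (M : mode_space V)
    (lam mu : R[i]) : set M :=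
  gen_eigenspace (J0 J (M := M)) lam `&` gen_eigenspace (L0 M) mu.
Arguments joint_space {R V} J M lam mu.

(* A grading-restricted generalized V-module: graded by joint generalized
   eigenvalues (lam, mu) of (J_0, L_0), with finite-dimensional graded pieces
   which, for fixed lam, vanish when mu is lowered by a large integer; these
   are the conditions under which the graded dual is again such a module.  The
   L_(-1)-derivative property and the Virasoro relations on M follow from the
   Borcherds identity. *)
Record gmodule (R : realType) (V : voa R) (J : V) := GModule {
  gm_space :> mode_space V;
  gm_bilinear : bilinear_modes (act gm_space);
  gm_truncated : lower_truncated (act gm_space);
  gm_vacuum : vacuum_acts (voa_vac V) (act gm_space);
  gm_borcherds : borcherds (@voa_mode R V) (act gm_space);
  gm_graded :
    sums_of [set v | exists lam mu, joint_space J gm_space lam mu v];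
  gm_finite : forall lam mu, finite_dim (joint_space J gm_space lam mu);
  gm_bounded : forall lam mu, exists N : nat, forall n : nat, (N <= n)%N ->
    joint_space J gm_space lam (mu - n%:R) `<=` [set 0]
}.

Section Modules.
Variables (R : realType) (V : voa R).
Implicit Types M N : mode_space V.

Definition is_hom M N (f : M -> N) : Prop :=
  linear f /\ forall a n u, f (act M a n u) = act N a n (f u).

Definition is_iso M N (f : M -> N) : Prop := is_hom f /\ bijective f.

Definition isomorphic M N : Prop := exists f : M -> N, is_iso f.

Definition submodule M (S : set M) : Prop :=
  [/\ S 0,
      forall (c : R[i]) u v, S u -> S v -> S (c *: u + v) &
      forall a n u, S u -> S (act M a n u)].

Definition simple_module M : Prop :=
  (exists u : M, u != 0) /\
  forall S : set M, submodule S -> S = [set 0] \/ S = [set: M].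

Definition indecomposable M : Prop :=
  (exists u : M, u != 0) /\
  forall S T : set M, submodule S -> submodule T ->
    S `&` T = [set 0] ->
    (forall u, exists s t, [/\ S s, T t & u = s + t]) ->
    S = [set 0] \/ T = [set 0].

Definition simple_submodule M (S : set M) : Prop :=
  [/\ submodule S, S <> [set 0] &
      forall T : set M, submodule T -> T `<=` S -> T = [set 0] \/ T = S].

Definition maximal_submodule M (S : set M) : Prop :=
  [/\ submodule S, S <> [set: M] &
      forall T : set M, submodule T -> S `<=` T -> T = S \/ T = [set: M]].

(* The sum of all simple submodules. *)
Definition socle M : set M :=
  [set u | forall S : set M, submodule S ->
             (forall T, simple_submodule T -> T `<=` S) -> S u].

(* The intersection of all maximal submodules; the head of M is
   M / radical M. *)
Definition radical M : set M :=
  [set u | forall S : set M, maximal_submodule S -> S u].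

Arguments socle : clear implicits.
Arguments radical : clear implicits.

Definition dsum M N : mode_space V :=
  {| ms_car := (M * N)%type;
     act := fun a n u => (act M a n u.1, act N a n u.2) |}.

(* S <= T are submodules of M, and T / S is isomorphic to N through the map
   induced by f; the values of f outside T are irrelevant. *)
Definition subquotient_iso M (S T : set M) N : Prop :=
  [/\ submodule S, submodule T, S `<=` T &
    exists f : M -> N,
      [/\ forall (c : R[i]) u v, T u -> T v -> f (c *: u + v) = c *: f u + f v,
          forall a n u, T u -> f (act M a n u) = act N a n (f u),
          forall w, exists2 u, T u & f u = w &
          forall u, T u -> (f u = 0 <-> S u)]].

(* An arrow X -> Y: T / S is isomorphic to Y, U / T is isomorphic to X, and
   U / S is not the direct sum of T / S and a complement W / S. *)
Definition arrow M (S T U : set M) (X Y : mode_space V) : Prop :=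
  [/\ subquotient_iso S T Y, subquotient_iso T U X &
    ~ exists W : set M,
        [/\ submodule W, W `<=` U, W `&` T = S &
            forall u, U u -> exists w t, [/\ W w, T t & u = w + t]]].

(* The layers are the head, radical / socle and the socle.  The arrows out of
   the top live in quotients of P / socle P, those into the bottom in
   submodules of radical P, so each one joins the indicated layers. *)
Definition loewy_diamond (P top mid1 mid2 bot : mode_space V) : Prop :=
  [/\ subquotient_iso (radical P) [set: P] top,
      subquotient_iso (socle P) (radical P) (dsum mid1 mid2) &
      subquotient_iso [set 0] (socle P) bot] /\
  [/\ (exists2 S, socle P `<=` S & arrow S (radical P) [set: P] top mid1),
      (exists2 S, socle P `<=` S & arrow S (radical P) [set: P] top mid2),
      (exists2 U, U `<=` radical P & arrow [set 0] (socle P) U mid1 bot) &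
      (exists2 U, U `<=` radical P & arrow [set 0] (socle P) U mid2 bot)].

Definition short_exact (M E N : mode_space V) (i : M -> E) (p : E -> N) : Prop :=
  [/\ is_hom i, is_hom p, injective i, (forall w, exists u, p u = w) &
      forall u, p u = 0 <-> exists m, i m = u].

Definition split_extension (M E N : mode_space V) (i : M -> E) (p : E -> N) : Prop :=
  exists s : N -> E, is_hom s /\ forall w, p (s w) = w.

Definition nonsplit_extension (M E N : mode_space V) : Prop :=
  exists (i : M -> E) (p : E -> N), short_exact i p /\ ~ split_extension i p.

End Modules.
Arguments socle {R V} M.
Arguments radical {R V} M.

(* Ext^1(N, M) = 0 in the category of generalized modules (Yoneda): every
   extension of N by M is split. *)
Definition Ext1_zero (R : realType) (V : voa R) (J : V) (N M : gmodule J) : Prop :=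
  forall (E : gmodule J) (i : M -> E) (p : E -> N),
    short_exact i p -> split_extension i p.

Definition J0_eigenvalues_in (R : realType) (V : voa R) (J : V)
    (M : mode_space V) (h : R[i]) : Prop :=
  forall (lam : R[i]) (u : M), u != 0 -> op_eigenspace (J0 J (M := M)) lam u ->
    exists n : int, lam = h + n%:~R.

Definition J0_semisimple (R : realType) (V : voa R) (J : V)
    (M : mode_space V) : Prop :=
  semisimple_op (J0 J (M := M)).

(* pi = e^(-2 pi i h) exp(2 pi i J_0) - Id *)
Definition pi_op (R : realType) (V : voa R) (J : V) (h : R[i])
    (M : mode_space V) (u : M) : M :=
  cexp (- (two_pi_i R * h)) *:
    opexp (fun x : M => two_pi_i R *: J0 J x) u - u.

(* 0 -> E -> E2 -> E -> 0 is exact and non-split with second map pi: pi is an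
   endomorphism of E2, and it is the composite of the surjection p with an
   isomorphism j from E onto the image of pi. *)
Definition nonsplit_pi_extension (R : realType) (V : voa R) (J : V) (h : R[i])
    (E E2 : mode_space V) : Prop :=
  is_hom (pi_op J h (M := E2)) /\
  exists (i : E -> E2) (p : E2 -> E) (j : E -> E2),
    [/\ short_exact i p, ~ split_extension i p, is_hom j, injective j &
        forall u, pi_op J h u = j (p u)].

(* Main.v *)
Require Import Defs.
From HB Require Import structures.
From mathcomp Require Import all_boot all_order all_algebra.
From mathcomp Require Import complex ring.
From mathcomp Require Import all_classical all_reals all_analysis.

Set Implicit Arguments.
Unset Strict Implicit.
Unset Printing Implicit Defensive.
Import Order.TTheory GRing.Theory Num.Theory.
Local Open Scope classical_set_scope.
Local Open Scope complex_scope.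
Local Open Scope ring_scope.

(* Put pi = e^(-2 pi i h) exp(2 pi i J_0) - Id.  As A, B are non-isomorphic simple
   modules on which pi vanishes, pi vanishes on E = E_B too, and comparing
   submodules of the uniserial module E shows that ker pi = im pi in E_B^(2);
   so pi = j p for a short exact sequence 0 -> E -j-> E_B^(2) -p-> E -> 0, and
   likewise for F = F_C.  Let Q be the fibre product of E_B^(2) and F_C^(2) over
   A, formed along E_B^(2) -> E -> A and F_C^(2) -> F <- A.  Then pi maps Q onto a
   copy K of E, and P_A = Q / K.  By construction pi = 0 on P_A, which makes J_0
   semisimple there.
   The arrows A -> B and C -> A are those of E and F.  If A -> C or B -> A were
   split, a subquotient of F_C^(2) or E_B^(2) would be a self-extension of A
   on which pi is not zero; but self-extensions of A split, and pi vanishes on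
   A + A.  Finally the four arrows force the socle and the radical of P_A. *)

(** * Polynomials in a linear operator *)

(** A is isomorphic neither to B nor to C, since a non-split extension of isomorphic modules would
    contradict the vanishing of self-extensions. Dividing by K kills the lower B of E_B^(2) and
    identifies its lower A with that of F_C^(2). The arrows A -> C and B -> A do not occur in E and
    F, so nothing is known about them there; they are tested on the two copies of A inside F_C^(2)
    or E_B^(2), where pi carries the upper copy onto the lower one. That B and C are not isomorphic
    excludes diagonal submodules of B + C, which would spoil the Loewy diagram. Two obstacles shape
    the argument. The exponential is a chosen operator, with a default value if there is none; so it
    is handled one generalized eigenvector at a time, as a finite sum that every homomorphism
    respects. And Ext^1 ranges over graded modules only, so a subquotient must first be built as
    such a module, with weight vectors, finite-dimensional pieces and lower bounds. This works
    because weight components are obtained by polynomials in J_0 and L_0, which preserve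
    submodules. *)

Definition pev (F : fieldType) (M : lmodType F) (D : M -> M) (p : {poly F})
    (v : M) : M :=
  \sum_(i < size p) p`_i *: iter i D v.

Section LinearMaps.
Variables (F : fieldType) (M N : lmodType F) (f : M -> N).
Hypothesis lf : linear f.

Lemma linP c u v : f (c *: u + v) = c *: f u + f v. Proof. exact: lf. Qed.
Lemma linD u v : f (u + v) = f u + f v.
Proof. by have := lf 1 u v; rewrite !scale1r. Qed.
Lemma lin0 : f 0 = 0.
Proof. by apply: (@addIr _ (f 0)); rewrite -linD !add0r. Qed.
Lemma linZ c u : f (c *: u) = c *: f u.
Proof. by rewrite -[c *: u]addr0 linP lin0 addr0. Qed.
Lemma linN u : f (- u) = - f u.
Proof. by rewrite -scaleN1r linZ scaleN1r. Qed.
Lemma linB u v : f (u - v) = f u - f v.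
Proof. by rewrite linD linN. Qed.
Lemma lin_sum (I : Type) (r : seq I) (P : pred I) (G : I -> M) :
  f (\sum_(i <- r | P i) G i) = \sum_(i <- r | P i) f (G i).
Proof. by apply: (big_morph f linD lin0). Qed.
Lemma lin_inj : (forall u, f u = 0 -> u = 0) -> injective f.
Proof.
move=> h u v e; apply/eqP; rewrite -subr_eq0; apply/eqP/h.
by rewrite linB e subrr.
Qed.
End LinearMaps.

Section PolynomialEvaluation.
Variables (F : fieldType) (M : lmodType F) (D : M -> M).
Hypothesis lD : linear D.

Lemma iter_linear k : linear (iter k D).
Proof. by elim: k => [|k IH] c u v //=; rewrite IH linP. Qed.

Lemma pev_widen n (p : {poly F}) v : (size p <= n)%N ->
  pev D p v = \sum_(i < n) p`_i *: iter i D v.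
Proof.
move=> le; rewrite /pev (big_ord_widen _ (fun i => p`_i *: iter i D v) le).
rewrite big_mkcond /=; apply: eq_bigr => i _.
by case: ltnP => // h; rewrite nth_default // scale0r.
Qed.

Lemma pev_linear p : linear (pev D p).
Proof.
move=> c u v; rewrite /pev scaler_sumr -big_split /=; apply: eq_bigr => i _.
by rewrite (iter_linear i) scalerDr !scalerA mulrC.
Qed.

Lemma pevDl p q v : pev D (p + q) v = pev D p v + pev D q v.
Proof.
have h : (size (p + q)%R <= maxn (size p) (size q))%N := size_polyD p q.
rewrite (pev_widen _ h) (pev_widen _ (leq_maxl (size p) (size q))).
rewrite (pev_widen _ (leq_maxr (size p) (size q))) -big_split /=.
by apply: eq_bigr => i _; rewrite coefD scalerDl.
Qed.

Lemma pevZl c p v : pev D (c *: p) v = c *: pev D p v.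
Proof.
rewrite (pev_widen _ (size_scale_leq c p)) /pev scaler_sumr.
by apply: eq_bigr => i _; rewrite coefZ scalerA.
Qed.

Lemma pevC c v : pev D c%:P v = c *: v.
Proof.
by rewrite (pev_widen _ (size_polyC_leq1 c)) big_ord1 coefC.
Qed.

Lemma pevMX p v : pev D (p * 'X) v = pev D p (D v).
Proof.
have h : (size (p * 'X)%R <= (size p).+1)%N.
  by rewrite (leq_trans (size_polyMleq _ _)) // size_polyX addn2.
rewrite (pev_widen _ h) big_ord_recl coefMX scale0r add0r.
by apply: eq_bigr => i _; rewrite coefMX /= -iterSr.
Qed.

Lemma pevXM p v : pev D ('X * p) v = D (pev D p v).
Proof.
rewrite mulrC pevMX /pev lin_sum //; apply: eq_bigr => i _.
by rewrite linZ // -iterSr.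
Qed.

Lemma pevM p q v : pev D (p * q) v = pev D p (pev D q v).
Proof.
elim/poly_ind: p => [|p c IH] in q v *.
  by rewrite mul0r /pev !size_poly0 !big_ord0.
rewrite mulrDl -mulrA !pevDl IH pevXM pevMX mul_polyC pevZl pevC.
by [].
Qed.

End PolynomialEvaluation.

(** * Generalized eigenspaces and their projectors *)

Section GeneralizedEigenspaces.
Variables (R : realType) (M : lmodType R[i]) (D : M -> M).
Hypothesis lD : linear D.

(** Makes the annihilation of a generalized eigenvector a statement about polynomials, to which
    Bezout applies. *)
Lemma shift_iter_pev lam k v : shift_iter D lam k v = pev D (('X - lam%:P) ^+ k) v.
Proof.
elim: k => [|k IH]; first by rewrite expr0 pevC scale1r.
rewrite exprS mulrBl mul_polyC -scaleNr pevDl pevXM // pevZl -IH.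
by rewrite scaleNr.
Qed.

Lemma shift_iter_linear lam k : linear (shift_iter D lam k).
Proof. by move=> c u v; rewrite !shift_iter_pev pev_linear. Qed.

Lemma shift_iterD lam k l v :
  shift_iter D lam (k + l) v = shift_iter D lam k (shift_iter D lam l v).
Proof. by rewrite /shift_iter iterD. Qed.

Lemma shift_iter_widen lam k l v : (k <= l)%N ->
  shift_iter D lam k v = 0 -> shift_iter D lam l v = 0.
Proof.
move=> le h; rewrite -(subnK le) shift_iterD h.
by rewrite lin0 //; apply: shift_iter_linear.
Qed.

Lemma gen_eigenspace_linear lam c u v : gen_eigenspace D lam u ->
  gen_eigenspace D lam v -> gen_eigenspace D lam (c *: u + v).
Proof.
move=> [m hm] [n hn]; exists (maxn m n).
rewrite (shift_iter_linear lam) (shift_iter_widen (leq_maxl m n) hm).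
by rewrite (shift_iter_widen (leq_maxr m n) hn) scaler0 addr0.
Qed.

Lemma gen_eigenspace0 lam : gen_eigenspace D lam 0.
Proof. by exists 0. Qed.

Lemma gen_eigenspace_sum lam (I : Type) (r : seq I) (P : pred I) (G : I -> M) :
  (forall i, P i -> gen_eigenspace D lam (G i)) ->
  gen_eigenspace D lam (\sum_(i <- r | P i) G i).
Proof.
move=> h; apply: big_ind => [|u v hu hv|i /h //].
  exact: gen_eigenspace0.
by rewrite -[u]scale1r; apply: gen_eigenspace_linear.
Qed.

(* By Bezout for the coprime polynomials (X - lam)^N and
   prod_(mu <> lam) (X - mu)^N. *)
Lemma eigen_projector lam (s : seq (R[i] * M)) :
  {in s, forall x, gen_eigenspace D x.1 x.2} ->
  exists p, {in s, forall x, pev D p x.2 = if x.1 == lam then x.2 else 0}.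
Proof.
move=> hs.
have [N hN] : exists N, {in s, forall x, shift_iter D x.1 N x.2 = 0}.
  elim: s hs => [|x s IH] hs; first by exists 0.
  have [|N hN] := IH; first by move=> y ys; apply: hs; rewrite inE ys orbT.
  have [n hn] := hs x (mem_head _ _).
  exists (maxn n N) => y; rewrite inE => /orP[/eqP->|ys].
    exact: shift_iter_widen (leq_maxl _ _) hn.
  exact: shift_iter_widen (leq_maxr _ _) (hN _ ys).
pose P := ('X - lam%:P) ^+ N.
pose Q := \prod_(x <- s | x.1 != lam) ('X - x.1%:P) ^+ N.
have cPQ : coprimep P Q.
  rewrite /Q; apply: (big_ind (fun q => coprimep P q)) => [|q r hq hr|x hx].
  - exact: coprimep1.
  - by rewrite coprimepMr hq.
  - apply: coprimep_expl; apply: coprimep_expr.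
    by rewrite coprimep_XsubC root_XsubC.
have [[u v] /= uv] := Bezout_eq1_coprimepP P Q cPQ.
(* [v * Q] is 1 modulo [P], hence fixes the vectors of eigenvalue [lam]; for any other listed vector
   [Q] contains the factor that annihilates it. *)
exists (v * Q) => x xs; case: eqP => [e|/eqP ne].
  have : pev D (u * P + v * Q) x.2 = x.2 by rewrite uv pevC scale1r.
  rewrite pevDl pevM // -/(pev _ _ _) /P -shift_iter_pev -{1}e hN //.
  by rewrite (lin0 (pev_linear lD u)) add0r.
have [Q' ->] : exists Q', Q = Q' * ('X - x.1%:P) ^+ N.
  by rewrite /Q (big_rem x xs) /= ne mulrC; eexists.
rewrite mulrA pevM // -shift_iter_pev hN //.
by rewrite (lin0 (pev_linear lD _)).
Qed.

End GeneralizedEigenspaces.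

(** * Exponentials *)

Section ComplexExponential.
Variable R : realType.

Lemma cexpD (z w : R[i]) : cexp (z + w) = cexp z * cexp w.
Proof.
case: z w => [a b] [c d]; rewrite /cexp /= expRD cosD sinD.
by apply/eqP; rewrite eq_complex /=; apply/andP; split; apply/eqP; simpc; ring.
Qed.

Lemma cexp0 : cexp (0 : R[i]) = 1.
Proof. by rewrite /cexp /= expR0 cos0 sin0 mul1r. Qed.

Lemma cexp_neq0 (z : R[i]) : cexp z != 0.
Proof.
apply/eqP => e; have := cexpD z (- z).
by rewrite e mul0r subrr cexp0 => /eqP; rewrite oner_eq0.
Qed.

Lemma cexp_nat_period n : cexp (two_pi_i R * n%:R) = 1.
Proof.
elim: n => [|n IH]; first by rewrite mulr0 cexp0.
rewrite -natr1 mulrDr cexpD IH mul1r mulr1 /cexp /two_pi_i /= expR0.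
by rewrite mulr_natl cos2pi sin2pi mul1r.
Qed.

Lemma cexp_int_period (n : int) : cexp (two_pi_i R * n%:~R) = 1.
Proof.
case: n => n; first exact: cexp_nat_period.
have := cexp_nat_period n.+1; rewrite NegzE mulrNz mulrN => e.
by apply: (mulIf (cexp_neq0 (two_pi_i R * n.+1%:R))); rewrite -cexpD addNr cexp0 e mul1r.
Qed.

Lemma two_pi_i_neq0 : two_pi_i R != 0.
Proof.
rewrite /two_pi_i eq_complex /= eqxx /= mulf_neq0 //.
by rewrite gt_eqF // pi_gt0.
Qed.
End ComplexExponential.

Section ExponentialSums.
Variables (R : realType).

(** The value that [is_opexp] prescribes at a vector killed by (D - lam)^N, kept apart from any
    operator realizing it. *)
Definition expsum (M : lmodType R[i]) (D : M -> M) lam N v :=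
  cexp lam *: \sum_(k < N) (k`!)%:R^-1 *: shift_iter D lam k v.

Variables (M : lmodType R[i]) (D : M -> M).
Hypothesis lD : linear D.

Lemma expsum_linear lam N : linear (expsum D lam N).
Proof.
have lS : linear (fun v => \sum_(k < N) (k`!)%:R^-1 *: shift_iter D lam k v).
  move=> c u v; rewrite scaler_sumr -big_split; apply: eq_bigr => k _ /=.
  by rewrite (shift_iter_linear lD) scalerDr !scalerA mulrC.
by move=> c u v; rewrite /expsum lS scalerDr !scalerA mulrC.
Qed.

Lemma shift_iter_eigen lam k v : D v = lam *: v ->
  shift_iter D lam k v = if k == 0%N then v else 0.
Proof.
move=> e; case: k => // k; rewrite -addn1 shift_iterD /shift_iter /= e subrr.
by rewrite addn1; apply: lin0; apply: shift_iter_linear.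
Qed.

Lemma expsum_eigen lam N v : D v = lam *: v -> shift_iter D lam N v = 0 ->
  expsum D lam N v = cexp lam *: v.
Proof.
move=> e; case: N => [|N] h; rewrite /expsum.
  by move: h; rewrite /shift_iter /= => ->; rewrite big_ord0 !scaler0.
rewrite big_ord_recl big1 ?addr0 => [|k _]; last first.
  by rewrite shift_iter_eigen // scaler0.
by rewrite shift_iter_eigen //= fact0 invr1 scale1r.
Qed.

(* For the least n with (D - lam)^n v = 0, compare (D - lam)^(n-1) and
   (D - lam)^(n-2) of both sides. *)
Lemma eigen_of_scalar_expsum lam N v c : shift_iter D lam N v = 0 ->
  expsum D lam N v = c *: v -> D v = lam *: v.
Proof.
move=> h e; case: (eqVneq v 0) => [->|v0]; first by rewrite lin0 // scaler0.
pose P n := shift_iter D lam n v == 0.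
have exP : exists n, P n by exists N; apply/eqP.
case: (ex_minnP exP) => n /eqP hn minn.
have lS k : linear (shift_iter D lam k) by apply: shift_iter_linear.
have vanish k : (n <= k)%N -> shift_iter D lam k v = 0.
  by move=> nk; apply: shift_iter_widen nk hn.
have nz k : (k < n)%N -> shift_iter D lam k v != 0.
  by move=> kn; apply: contraL kn => hk; rewrite -leqNgt; apply: minn.
have nN : (n <= N)%N by apply: minn; apply/eqP.
case: n => [|[|n]] in hn minn vanish nz nN *.
- by move: hn v0; rewrite /shift_iter /= => ->; rewrite eqxx.
- by move: hn; rewrite /shift_iter /= => /eqP; rewrite subr_eq0 => /eqP.
have key m : cexp lam *: \sum_(k < N) (k`!)%:R^-1 *: shift_iter D lam (m + k) v
    = c *: shift_iter D lam m v.
  rewrite -(linZ (lS m)) -e /expsum (linZ (lS m)) (lin_sum (lS m)).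
  by congr (_ *: _); apply: eq_bigr => k _; rewrite (linZ (lS m)) shift_iterD.
case: N => [|[|N]] // in h e nN key *.
have cE : cexp lam = c.
  have /eqP := key n.+1; rewrite big_ord_recl big1 => [|k _]; last first.
    by rewrite vanish ?scaler0 // addnS /= ltnS leq_addr.
  rewrite addr0 fact0 invr1 scale1r addn0 -subr_eq0 -scalerBl scaler_eq0.
  by rewrite (negbTE (nz _ _)) // orbF subr_eq0 => /eqP.
(* The least exponent is now [n.+2]. With [cexp lam = c] the terms k = 0 cancel, and the term k = 1
   says that (D - lam)^(n+1) v vanishes, against minimality. *)
have := key n; rewrite big_ord_recl big_ord_recl big1 => [|k _]; last first.
  by rewrite vanish ?scaler0 // !addnS /= !ltnS leq_addr.
rewrite /= (_ : bump 0 0 = 1%N) // addr0 addn0 addn1 !factS !fact0 !muln1 invr1 !scale1r.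
rewrite scalerDr cE -[RHS]addr0 => /addrI/eqP.
by rewrite scaler_eq0 -cE (negbTE (cexp_neq0 _)) (negbTE (nz _ _)).
Qed.

End ExponentialSums.

(** All conditions are relative to [Q], because the map of a subquotient is uncontrolled outside its
    domain; stability of [Q] is therefore carried through the induction. *)
Lemma shift_iter_commute (R : realType) (M N : lmodType R[i]) (Q : set M)
    (D : M -> M) (D' : N -> N) (f : M -> N) lam n v :
  (forall c u w, Q u -> Q w -> Q (c *: u + w)) -> (forall u, Q u -> Q (D u)) ->
  (forall c u w, Q u -> Q w -> f (c *: u + w) = c *: f u + f w) ->
  (forall u, Q u -> f (D u) = D' (f u)) -> Q v ->
  Q (shift_iter D lam n v) /\
  f (shift_iter D lam n v) = shift_iter D' lam n (f v).
Proof.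
move=> Qlin QD lf fD Qv; elim: n => [//|n]; rewrite /shift_iter !iterS.
set w := iter n _ v => -[Qw fw].
have -> : D w - lam *: w = - lam *: w + D w by rewrite scaleNr addrC.
split; first by apply: Qlin => //; apply: QD.
by rewrite lf ?fD ?fw //; [rewrite scaleNr addrC | apply: QD].
Qed.

Lemma expsum_commute (R : realType) (M N : lmodType R[i]) (Q : set M)
    (D : M -> M) (D' : N -> N) (f : M -> N) lam n v :
  Q 0 ->
  (forall c u w, Q u -> Q w -> Q (c *: u + w)) -> (forall u, Q u -> Q (D u)) ->
  (forall c u w, Q u -> Q w -> f (c *: u + w) = c *: f u + f w) ->
  (forall u, Q u -> f (D u) = D' (f u)) -> Q v ->
  Q (expsum D lam n v) /\ f (expsum D lam n v) = expsum D' lam n (f v).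
Proof.
move=> Q0 Qlin QD lf fD Qv.
have f0 : f 0 = 0.
  have := lf (- 1) _ _ Q0 Q0; rewrite scaleNr scale1r addNr => ->.
  by rewrite scaleNr scale1r addNr.
have fZ c u : Q u -> Q (c *: u) /\ f (c *: u) = c *: f u.
  move=> Qu; have e : c *: u = c *: u + 0 by rewrite addr0.
  by split; rewrite e; [apply: Qlin | rewrite lf // f0 addr0].
have [QS fS] : Q (\sum_(k < n) (k`!)%:R^-1 *: shift_iter D lam k v) /\
    f (\sum_(k < n) (k`!)%:R^-1 *: shift_iter D lam k v) =
    \sum_(k < n) (k`!)%:R^-1 *: shift_iter D' lam k (f v).
  apply: (big_ind2 (fun u w => Q u /\ f u = w)) => // [u u' w w'|k _].
    move=> [Qu <-] [Qw <-]; have := lf 1 u w Qu Qw; have := Qlin 1 u w Qu Qw.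
    by rewrite !scale1r.
  have [Qk <-] := shift_iter_commute lam k Qlin QD lf fD Qv.
  exact: fZ.
by rewrite /expsum -fS; apply: fZ.
Qed.

(** * Subquotients *)

Section SubmoduleFacts.
Variables (R : realType) (V : voa R) (M : mode_space V) (S : set M).
Hypothesis sS : submodule S.

Lemma sub0 : S 0. Proof. by case: sS. Qed.
Lemma subP c u v : S u -> S v -> S (c *: u + v). Proof. by case: sS => _ h _; apply: h. Qed.
Lemma subact a n u : S u -> S (act M a n u). Proof. by case: sS => _ _; apply. Qed.
Lemma subD u v : S u -> S v -> S (u + v).
Proof. by move=> hu hv; rewrite -[u]scale1r; apply: subP. Qed.
Lemma subZ c u : S u -> S (c *: u).
Proof. by move=> hu; rewrite -[_ *: _]addr0; apply: subP => //; apply: sub0. Qed.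
Lemma subN u : S u -> S (- u).
Proof. by move=> hu; rewrite -scaleN1r; apply: subZ. Qed.
Lemma subB u v : S u -> S v -> S (u - v).
Proof. by move=> hu hv; apply: subD => //; apply: subN. Qed.
Lemma sub_sum (I : Type) (r : seq I) (P : pred I) (F : I -> M) :
  (forall i, P i -> S (F i)) -> S (\sum_(i <- r | P i) F i).
Proof.
by move=> h; apply: big_ind => // [|u v]; [apply: sub0|apply: subD].
Qed.
End SubmoduleFacts.

Section Subquotient.
Variables (R : realType) (V : voa R) (M : mode_space V) (K Q : set M).
Hypotheses (sK : submodule K) (sQ : submodule Q).

(* The value is 0 when u is not in Q. *)
Definition coset_rep (u : M) : M := xget 0 [set v | Q v /\ K (u - v)].

Lemma coset_repP u : Q u -> Q (coset_rep u) /\ K (u - coset_rep u).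
Proof.
move=> Qu; suff : [set v | Q v /\ K (u - v)] (coset_rep u) by [].
by apply: (xgetI 0 (x := u)); split=> //; rewrite subrr; apply: (sub0 sK).
Qed.

Lemma coset_rep_eq u v : K (u - v) -> coset_rep u = coset_rep v.
Proof.
move=> Kuv; congr xget; apply/seteqP; split=> w [Qw Kw]; split=> //.
  have -> : v - w = (u - w) - (u - v) by rewrite opprB [RHS]addrC subrKA.
  exact: (subB sK).
by rewrite -(subrKA v); apply: (subD sK).
Qed.

(** The quotient of [Q] by [K] is carried by chosen representatives: equality in it is then plain
    equality, and its choice structure is inherited from [M]. *)
Definition is_coset_rep u := `[< Q u /\ coset_rep u = u >].

Definition subquot := {u : M | is_coset_rep u}.

Lemma coset_rep_fixed u : Q u -> is_coset_rep (coset_rep u).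
Proof.
move=> /coset_repP[Qr Kr]; apply/asboolP; split=> //; apply: coset_rep_eq.
by rewrite -opprB; apply: (subN sK).
Qed.

Definition sq_proj (u : M) : subquot :=
  insubd (exist (fun u => is_coset_rep u) _ (coset_rep_fixed (sub0 sQ)))
    (coset_rep u).

Lemma sq_projK u : Q u -> val (sq_proj u) = coset_rep u.
Proof. by move=> Qu; rewrite insubdK //; apply: coset_rep_fixed. Qed.

Lemma sq_val_in (x : subquot) : Q (val x).
Proof. by case: x => u /= /asboolP[]. Qed.

Lemma sq_valK (x : subquot) : sq_proj (val x) = x.
Proof.
apply: val_inj; rewrite sq_projK; last exact: sq_val_in.
by case: x => u /= /asboolP[].
Qed.

Lemma sq_proj_eq u v : Q u -> Q v -> (sq_proj u = sq_proj v <-> K (u - v)).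
Proof.
move=> Qu Qv; split=> [/(congr1 val)|Kuv]; last first.
  by apply: val_inj; rewrite !sq_projK //; apply: coset_rep_eq.
rewrite !sq_projK // => e; have [_ Ku] := coset_repP Qu.
have [_ Kv] := coset_repP Qv.
have -> : u - v = (u - coset_rep u) - (v - coset_rep v).
  by rewrite e opprB subrKA.
exact: (subB sK).
Qed.

Lemma sq_projP (x : subquot) : exists2 u, Q u & x = sq_proj u.
Proof. by exists (val x); [apply: sq_val_in|rewrite sq_valK]. Qed.

Lemma sq_val_proj u : Q u -> K (val (sq_proj u) - u).
Proof.
by move=> Qu; apply/sq_proj_eq => //; [apply: sq_val_in|rewrite sq_valK].
Qed.

Definition sq_add (x y : subquot) : subquot := sq_proj (val x + val y).
Definition sq_opp (x : subquot) : subquot := sq_proj (- val x).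
Definition sq_scale c (x : subquot) : subquot := sq_proj (c *: val x).
Definition sq_act a n (x : subquot) : subquot := sq_proj (act M a n (val x)).

Lemma sq_addE u v : Q u -> Q v -> sq_add (sq_proj u) (sq_proj v) = sq_proj (u + v).
Proof.
move=> Qu Qv; apply/sq_proj_eq; try (apply: (subD sQ) => //; exact: sq_val_in).
by rewrite opprD addrACA; apply: (subD sK); apply: sq_val_proj.
Qed.

Lemma sq_oppE u : Q u -> sq_opp (sq_proj u) = sq_proj (- u).
Proof.
move=> Qu; apply/sq_proj_eq; try (apply: (subN sQ) => //; exact: sq_val_in).
by rewrite -opprD; apply: (subN sK); apply: sq_val_proj.
Qed.

Lemma sq_scaleE c u : Q u -> sq_scale c (sq_proj u) = sq_proj (c *: u).
Proof.
move=> Qu; apply/sq_proj_eq; try (apply: (subZ sQ) => //; exact: sq_val_in).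
by rewrite -scalerBr; apply: (subZ sK); apply: sq_val_proj.
Qed.

Let QD := subD sQ.
Let QN := subN sQ.
Let QZ := subZ sQ.

Fact sq_addA : associative sq_add.
Proof.
move=> x y z; have [u Qu ->] := sq_projP x; have [v Qv ->] := sq_projP y.
by have [w Qw ->] := sq_projP z; rewrite !sq_addE ?addrA //; apply: QD.
Qed.
Fact sq_addC : commutative sq_add.
Proof. by move=> x y; rewrite /sq_add addrC. Qed.
Fact sq_add0 : left_id (sq_proj 0) sq_add.
Proof.
move=> x; have [u Qu ->] := sq_projP x.
by rewrite sq_addE ?add0r //; apply: (sub0 sQ).
Qed.
Fact sq_addN : left_inverse (sq_proj 0) sq_opp sq_add.
Proof.
move=> x; have [u Qu ->] := sq_projP x.
by rewrite sq_oppE // sq_addE ?addNr //; apply: QN.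
Qed.
HB.instance Definition _ := Choice.on subquot.
HB.instance Definition _ :=
  GRing.isZmodule.Build subquot sq_addA sq_addC sq_add0 sq_addN.

Fact sq_scaleA c d x : sq_scale c (sq_scale d x) = sq_scale (c * d) x.
Proof.
have [u Qu ->] := sq_projP x.
by rewrite !sq_scaleE // ?scalerA //; apply: QZ.
Qed.
Fact sq_scale1 : left_id 1 sq_scale.
Proof. by move=> x; have [u Qu ->] := sq_projP x; rewrite sq_scaleE ?scale1r. Qed.
Fact sq_scaleDr : right_distributive sq_scale +%R.
Proof.
move=> c x y; have [u Qu ->] := sq_projP x; have [v Qv ->] := sq_projP y.
rewrite [_ + _]sq_addE // !sq_scaleE //; last exact: QD.
by rewrite [RHS]sq_addE ?scalerDr //; apply: QZ.
Qed.
Fact sq_scaleDl x : {morph sq_scale^~ x : c d / c + d}.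
Proof.
move=> c d; have [u Qu ->] := sq_projP x; rewrite !sq_scaleE //.
by rewrite [RHS]sq_addE ?scalerDl //; apply: QZ.
Qed.
HB.instance Definition _ := GRing.Zmodule_isLmodule.Build R[i] subquot
  sq_scaleA sq_scale1 sq_scaleDr sq_scaleDl.

Definition subquot_space : mode_space V :=
  {| ms_car := subquot; act := sq_act |}.

Lemma sq_proj_lin c u v : Q u -> Q v ->
  sq_proj (c *: u + v) = c *: sq_proj u + sq_proj v.
Proof.
move=> Qu Qv; rewrite -sq_addE //; last exact: QZ.
by congr (_ + _); rewrite -sq_scaleE.
Qed.

Lemma sq_proj0 u : Q u -> (sq_proj u = 0 <-> K u).
Proof.
by move=> Qu; rewrite -{2}[u]subr0; apply: sq_proj_eq => //; apply: (sub0 sQ).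
Qed.
End Subquotient.

(** * Finite spans and their subspaces *)

Section FiniteSpans.
Variables (F : fieldType).
Implicit Types M N : lmodType F.

Definition in_span M (s : seq M) v :=
  exists c : nat -> F, v = \sum_(i < size s) c i *: s`_i.

Lemma in_span_nil M (v : M) : in_span [::] v <-> v = 0.
Proof.
split=> [[c ->]|->]; first by rewrite big_ord0.
by exists (fun=> 0); rewrite big_ord0.
Qed.

Lemma in_span_cons M x (s : seq M) v :
  in_span (x :: s) v <-> exists a w, in_span s w /\ v = a *: x + w.
Proof.
split=> [[c ->]|[a [w [[c ->] ->]]]].
  by rewrite big_ord_recl; exists (c 0%N), (\sum_(i < size s) c i.+1 *: s`_i);
    split=> //; exists (fun i => c i.+1).
by exists (fun i => if i is j.+1 then c j else a); rewrite [RHS]big_ord_recl.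
Qed.

Lemma in_span_lin M (s : seq M) c u v :
  in_span s u -> in_span s v -> in_span s (c *: u + v).
Proof.
move=> [a ->] [b ->]; exists (fun i => c * a i + b i).
rewrite scaler_sumr -big_split; apply: eq_bigr => i _ /=.
by rewrite scalerDl scalerA.
Qed.

Lemma in_span_catl M (s t : seq M) u : in_span s u -> in_span (s ++ t) u.
Proof.
elim: s u => [|x s IH] u /=.
  move/in_span_nil ->; elim: t => [|y t IH]; first exact/in_span_nil.
  by apply/in_span_cons; exists 0, 0; rewrite scale0r addr0.
move/in_span_cons => [a [w [hw ->]]]; apply/in_span_cons.
by exists a, w; split=> //; apply: IH.
Qed.

Lemma in_span_catr M (s t : seq M) u : in_span t u -> in_span (s ++ t) u.
Proof.
elim: s => [//|x s IH] /IH h /=; apply/in_span_cons.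
by exists 0, u; rewrite scale0r add0r.
Qed.

(** A list witnessing [finite_dim] may lie outside the subspace, where a partially defined map says
    nothing; here the generators are moved into [W]. Elimination: if some [w] in [W] is not in the
    span of the tail, it has a nonzero coefficient at [x] and serves as a pivot that clears [x] from
    every other vector of [W]. *)
Lemma subspace_spanned M (s : seq M) (W : set M) : W 0 ->
  (forall c u v, W u -> W v -> W (c *: u + v)) ->
  (forall v, W v -> in_span s v) ->
  exists t, {in t, forall x, W x} /\ forall v, W v -> in_span t v.
Proof.
elim: s W => [|x s IH] W W0 Wl Ws; first by exists [::].
have [|||t [tW ht]] := IH (W `&` in_span s); first 1 last.
- by move=> c u v [Wu su] [Wv sv]; split; [apply: Wl|apply: in_span_lin].
- by move=> v [].
- have [[w [Ww nw]]|no] := pselect (exists w, W w /\ ~ in_span s w); last first.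
    exists t; split=> [y /tW[] //|v Wv]; apply: ht; split=> //.
    by apply: contra_notP no => h; exists v.
  have /in_span_cons[a [w' [sw' e]]] := Ws _ Ww.
  have a0 : a != 0.
    by apply/eqP => a0; apply: nw; rewrite e a0 scale0r add0r.
  exists (w :: t); split=> [y|v Wv].
    by rewrite inE => /orP[/eqP->//|/tW[]].
  have /in_span_cons[b [v' [sv' ev]]] := Ws _ Wv.
  apply/in_span_cons; exists (b / a), (- (b / a) *: w + v).
  rewrite addrA scaleNr subrr add0r; split=> //.
  apply: ht; split; first by rewrite -scaleNr; apply: Wl.
  rewrite e ev scalerDr scalerA divfK // opprD [X in X + _]addrC -addrA addKr.
  by rewrite -scaleNr; apply: in_span_lin.
- split=> //; elim: (s) => [|y r IHr]; first exact/in_span_nil.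
  by apply/in_span_cons; exists 0, 0; rewrite scale0r addr0.
Qed.

Lemma in_span_map M N (Q : set M) (f : M -> N) (s : seq M) v :
  Q 0 -> (forall c u w, Q u -> Q w -> Q (c *: u + w)) ->
  f 0 = 0 ->
  (forall c u w, Q u -> Q w -> f (c *: u + w) = c *: f u + f w) ->
  {in s, forall x, Q x} -> in_span s v -> Q v /\ in_span (map f s) (f v).
Proof.
move=> Q0 Ql f0 fl; elim: s v => [|x s IH] v sQ.
  by move=> /in_span_nil ->; rewrite f0; split=> //; apply/in_span_nil.
move=> /in_span_cons[a [w [hw ->]]].
have [|Qw fw] := IH w _ hw; first by move=> y ys; apply: sQ; rewrite inE ys orbT.
have Qx : Q x by apply: sQ; rewrite mem_head.
rewrite fl //; split; first exact: Ql.
by apply/in_span_cons; exists a, (f w).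
Qed.

End FiniteSpans.

Lemma big_group_keys (M : nmodType) (K : eqType) (s : seq (K * M)) :
  \sum_(x <- s) x.2 =
  \sum_(k <- undup (map fst s)) \sum_(x <- s | x.1 == k) x.2.
Proof.
rewrite (exchange_big_dep xpredT) //=; apply: eq_big_seq => x xs.
rewrite -big_filter (_ : [seq k <- _ | _] = [:: x.1]) ?big_seq1 //.
rewrite (eq_filter (a2 := pred1 x.1)) => [|k]; last by rewrite /= eq_sym.
by rewrite filter_pred1_uniq ?undup_uniq // mem_undup map_f.
Qed.

Section JointProjector.
Variables (R : realType) (M : lmodType R[i]) (D L : M -> M).
Hypotheses (lD : linear D) (lL : linear L).

(** On a listed vector the first projector returns the vector itself or 0, so the second one applies
    to a listed vector again, whether or not [D] and [L] commute. *)
Lemma joint_projector (k : R[i] * R[i]) (s : seq ((R[i] * R[i]) * M)) :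
  {in s, forall x, gen_eigenspace D x.1.1 x.2 /\ gen_eigenspace L x.1.2 x.2} ->
  exists p q, {in s, forall x,
    pev L q (pev D p x.2) = if x.1 == k then x.2 else 0}.
Proof.
case: k => lam mu hs.
have [|p hp] := @eigen_projector _ _ _ lD lam [seq (x.1.1, x.2) | x <- s].
  by move=> _ /mapP[x xs ->]; have [] := hs x xs.
have [|q hq] := @eigen_projector _ _ _ lL mu [seq (x.1.2, x.2) | x <- s].
  by move=> _ /mapP[x xs ->]; have [] := hs x xs.
exists p, q => x xs; rewrite -pair_eqE /pair_eq /=.
have -> : pev D p x.2 = if x.1.1 == lam then x.2 else 0.
  by apply: (hp (x.1.1, x.2)); apply/mapP; exists x.
case: eqP => _ /=; last by rewrite lin0 //; apply: pev_linear.
by apply: (hq (x.1.2, x.2)); apply/mapP; exists x.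
Qed.
End JointProjector.

(** * Graded modules *)

Section PartialHoms.
Variables (R : realType) (V : voa R).
Implicit Types M N : mode_space V.

Definition hom_on M N (Q : set M) (f : M -> N) : Prop :=
  (forall c u v, Q u -> Q v -> f (c *: u + v) = c *: f u + f v) /\
  (forall a n u, Q u -> f (act M a n u) = act N a n (f u)).

Section HomOnFacts.
Variables (M N : mode_space V) (Q : set M) (f : M -> N).
Hypotheses (sQ : submodule Q) (hf : hom_on Q f).

Lemma hom_on0 : f 0 = 0.
Proof.
have Q0 := sub0 sQ; have := hf.1 (- 1) _ _ Q0 Q0.
by rewrite scaleNr scale1r addNr => ->; rewrite scaleNr scale1r addNr.
Qed.
Lemma hom_onZ c u : Q u -> f (c *: u) = c *: f u.
Proof.
by move=> Qu; have := hf.1 c _ _ Qu (sub0 sQ); rewrite hom_on0 !addr0.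
Qed.
Lemma hom_onD u v : Q u -> Q v -> f (u + v) = f u + f v.
Proof. by move=> Qu Qv; have := hf.1 1 _ _ Qu Qv; rewrite !scale1r. Qed.
Lemma hom_onN u : Q u -> f (- u) = - f u.
Proof. by move=> Qu; rewrite -scaleN1r hom_onZ // scaleN1r. Qed.
Lemma hom_onB u v : Q u -> Q v -> f (u - v) = f u - f v.
Proof. by move=> Qu Qv; rewrite hom_onD ?hom_onN //; apply: (subN sQ). Qed.
Lemma hom_on_sum (I : Type) (r : seq I) (P : pred I) (G : I -> M) :
  (forall i, P i -> Q (G i)) ->
  f (\sum_(i <- r | P i) G i) = \sum_(i <- r | P i) f (G i).
Proof.
move=> h; suff [] : Q (\sum_(i <- r | P i) G i) /\
  f (\sum_(i <- r | P i) G i) = \sum_(i <- r | P i) f (G i) by [].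
apply: (big_ind2 (fun u w => Q u /\ f u = w)) => [|u u' w w'|i Pi].
- by split; [apply: (sub0 sQ)|apply: hom_on0].
- by move=> [Qu <-] [Qw <-]; split; [apply: (subD sQ)|apply: hom_onD].
- by split=> //; apply: h.
Qed.
End HomOnFacts.

Lemma is_hom_on M N (Q : set M) (f : M -> N) : is_hom f -> hom_on Q f.
Proof. by move=> [lf af]; split=> *; [apply: lf|apply: af]. Qed.

Lemma subquotient_isoP M (S T : set M) N :
  subquotient_iso S T N <->
  [/\ submodule S, submodule T, S `<=` T &
    exists f : M -> N, [/\ hom_on T f, forall w, exists2 u, T u & f u = w &
      forall u, T u -> (f u = 0 <-> S u)]].
Proof.
split=> -[sS sT ST [f]].
  by move=> [f1 f2 f3 f4]; split=> //; exists f.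
by move=> [[f1 f2] f3 f4]; split=> //; exists f.
Qed.

End PartialHoms.

Lemma subquot_spaceP (R : realType) (V : voa R) (M : mode_space V)
    (K Q : set M) : submodule K -> submodule Q -> K `<=` Q ->
  (forall a n, linear (act M a n)) ->
  exists N : mode_space V, subquotient_iso K Q N.
Proof.
move=> sK sQ KQ lM; exists (subquot_space sK sQ); apply/subquotient_isoP; split=> //.
exists (sq_proj sK sQ); split.
- split=> [c u v Qu Qv|a n u Qu]; first exact: sq_proj_lin.
  rewrite /= /sq_act; apply/sq_proj_eq.
  + exact: (subact sQ).
  + by apply: (subact sQ); apply: sq_val_in.
  + rewrite -(linB (lM a n)); apply: (subact sK).
    by rewrite -opprB; apply: (subN sK); apply: sq_val_proj.
- by move=> w; have [u Qu ->] := sq_projP sK sQ w; exists u.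
- by move=> u Qu; apply: sq_proj0.
Qed.

Section GradedModules.
Variables (R : realType) (V : voa R) (J : V).

Lemma act_linear (M : gmodule J) a n : linear (act M a n).
Proof. by have [_ h] := gm_bilinear M; apply: h. Qed.

Arguments act_linear : clear implicits.

Lemma pev_submodule (M : mode_space V) (S : set M) a n p u : submodule S ->
  S u -> S (pev (act M a n) p u).
Proof.
move=> sS Su; apply: (sub_sum sS) => i _; apply: (subZ sS).
by elim: (i : nat) => //= k IH; apply: (subact sS).
Qed.

Lemma joint_space_sum (M : mode_space V) lam mu (I : Type) (r : seq I)
    (P : pred I) (G : I -> M) : (forall a n, linear (act M a n)) ->
  (forall i, P i -> joint_space J M lam mu (G i)) ->
  joint_space J M lam mu (\sum_(i <- r | P i) G i).
Proof.
move=> lM h; split; apply: gen_eigenspace_sum.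
- exact: lM.
- by move=> i /h[].
- exact: lM.
- by move=> i /h[].
Qed.

Lemma joint_space0 (M : mode_space V) lam mu : joint_space J M lam mu 0.
Proof. by split; apply: gen_eigenspace0. Qed.

Lemma joint_space_lin (M : mode_space V) lam mu c u v :
  (forall a n, linear (act M a n)) -> joint_space J M lam mu u ->
  joint_space J M lam mu v -> joint_space J M lam mu (c *: u + v).
Proof.
by move=> lM [u1 u2] [v1 v2]; split; apply: gen_eigenspace_linear => //; apply: lM.
Qed.

(** The projectors to weight components are polynomials in modes of [V], and a submodule is stable
    under these; so the components of [u] stay in [S]. *)
Lemma submodule_graded (M : gmodule J) (S : set M) u : submodule S -> S u ->
  exists s : seq ((R[i] * R[i]) * M),
    {in s, forall x, joint_space J M x.1.1 x.1.2 x.2 /\ S x.2} /\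
    u = \sum_(x <- s) x.2.
Proof.
move=> sS Su; have [r [hr eu]] := @gm_graded _ _ _ M u.
have [s [hs es]] : exists s : seq ((R[i] * R[i]) * M),
    {in s, forall x, joint_space J M x.1.1 x.1.2 x.2} /\ u = \sum_(x <- s) x.2.
  rewrite eu; elim: r hr {eu} => [|x r IH] hr.
    by exists [::]; rewrite !big_nil.
  have [|s [hs es]] := IH; first by move=> y ys; apply: hr; rewrite inE ys orbT.
  have [lam [mu hx]] := hr x (mem_head _ _).
  exists (((lam, mu), x) :: s); rewrite !big_cons es; split=> // y.
  by rewrite inE => /orP[/eqP->|/hs].
(* Terms of equal weight are added first: a projector separates different weights only, so it is
   these sums, not the single terms, that are seen to lie in [S]. *)
exists [seq (k, \sum_(x <- s | x.1 == k) x.2) | k <- undup (map fst s)].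
rewrite big_map -big_group_keys; split=> // _ /mapP[k _ ->] /=; split.
  rewrite big_seq_cond; apply: joint_space_sum; first exact: act_linear.
  by move=> x /andP[xs /eqP <-]; apply: hs.
have [p [q hpq]] := joint_projector (act_linear M J 0)
  (act_linear M (voa_omega V) 1) k hs.
have <- : pev (act M (voa_omega V) 1) q (pev (act M J 0) p u) =
    \sum_(x <- s | x.1 == k) x.2.
  rewrite es (lin_sum (pev_linear (act_linear M J 0) p)).
  rewrite (lin_sum (pev_linear (act_linear M (voa_omega V) 1) q)).
  by rewrite [RHS]big_mkcond; apply: eq_big_seq => x xs; apply: hpq.
by do 2 apply: pev_submodule => //.
Qed.

(** * Module axioms on subquotients *)

Section TransferToQuotient.
Variables (M : gmodule J) (N : mode_space V) (Q : set M) (f : M -> N).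
Hypotheses (sQ : submodule Q) (hf : hom_on Q f).
Hypothesis surj : forall w, exists2 u, Q u & f u = w.

Fact image_bilinear : bilinear_modes (act N).
Proof.
have [l1 l2] := gm_bilinear M; split=> [n w c a b|a n c v w].
  have [u Qu <-] := surj w; rewrite -!hf.2 // l1 hf.1 //; exact: (subact sQ).
have [u Qu <-] := surj w; have [u' Qu' <-] := surj v.
by rewrite -!hf.1 // -!hf.2 // ?l2 ?hf.1 //; try exact: (subact sQ); apply: (subP sQ).
Qed.

Fact image_truncated : lower_truncated (act N).
Proof.
move=> a w; have [u Qu <-] := surj w; have [n0 h] := gm_truncated (g := M) a u.
by exists n0 => n /h e; rewrite -hf.2 // e; apply: hom_on0 hf.
Qed.

Fact image_vacuum : vacuum_acts (voa_vac V) (act N).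
Proof.
move=> n w; have [u Qu <-] := surj w; rewrite -hf.2 // gm_vacuum.
by case: eqP => // _; apply: hom_on0 hf.
Qed.

Fact image_borcherds : borcherds (@voa_mode R V) (act N).
Proof.
move=> a b w m n k; have [u Qu <-] := surj w.
have [n0 h] := gm_borcherds (g := M) a b u m n k.
exists n0 => l /h e.
have Qa c p x : Q x -> Q (act M c p x) by apply: (subact sQ).
transitivity (f (\sum_(i < l)
   binz R m i *: act M (voa_mode a (n + i%:Z) b) (m + k - i%:Z) u)).
  rewrite (hom_on_sum sQ hf) => [|i _]; last by apply: (subZ sQ); apply: Qa.
  by apply: eq_bigr => i _; rewrite (hom_onZ sQ hf) ?hf.2 //; apply: Qa.
rewrite e (hom_on_sum sQ hf) => [|i _]; last first.
  apply: (subZ sQ); apply: (subB sQ); first by do 2 apply: (Qa _ _ _).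
  by apply: (subZ sQ); do 2 apply: (Qa _ _ _).
apply: eq_bigr => i _; rewrite (hom_onZ sQ hf); last first.
  by apply: (subB sQ); [|apply: (subZ sQ)]; do 2 apply: (Qa _ _ _).
rewrite (hom_onB sQ hf); [|by do 2 apply: (Qa _ _ _)|by apply: (subZ sQ); do 2 apply: (Qa _ _ _)].
rewrite (hom_onZ sQ hf); last by do 2 apply: (Qa _ _ _).
by rewrite !hf.2 //; apply: Qa.
Qed.

Let lN a n : linear (act N a n) := image_bilinear.2 a n.

Lemma hom_on_joint lam mu u : Q u -> joint_space J M lam mu u ->
  joint_space J N lam mu (f u).
Proof.
have QP c v w : Q v -> Q w -> Q (c *: v + w) by apply: (subP sQ).
have QD a n v : Q v -> Q (act M a n v) by apply: (subact sQ).
move=> Qu [[n1 h1] [n2 h2]]; split.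
- exists n1; have [_ <-] := shift_iter_commute lam n1 QP (QD J 0) hf.1 (hf.2 J 0) Qu.
  by rewrite [shift_iter _ _ _ _]h1; apply: hom_on0 hf.
- exists n2.
  have [_ <-] := shift_iter_commute mu n2 QP (QD _ 1) hf.1 (hf.2 (voa_omega V) 1) Qu.
  by rewrite [shift_iter _ _ _ _]h2; apply: hom_on0 hf.
Qed.

Fact image_graded : sums_of [set v | exists lam mu, joint_space J N lam mu v].
Proof.
move=> w; have [u Qu <-] := surj w; have [s [hs ->]] := submodule_graded sQ Qu.
exists [seq f x.2 | x <- s]; split.
  move=> _ /mapP[x /hs[jx Qx] ->]; exists x.1.1, x.1.2; exact: hom_on_joint.
rewrite big_map big_seq (hom_on_sum sQ hf) -?big_seq // => x xs.
by have [] := hs x xs.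
Qed.

(** An arbitrary preimage of [v] has components of many weights, but those of weight other than
    (lam, mu) contribute nothing to the image. Finite dimension and lower bounds descend to [N]
    through this lift. *)
Lemma joint_space_lift lam mu v : joint_space J N lam mu v ->
  exists u, [/\ Q u, joint_space J M lam mu u & f u = v].
Proof.
move=> jv; have [u Qu eu] := surj v; have [s [hs es]] := submodule_graded sQ Qu.
(* [v] itself is put on the list, so that the same polynomials fix [v] and select the components of
   weight (lam, mu) in its expansion. *)
have [|p [q hpq]] := joint_projector (lN J 0) (lN (voa_omega V) 1) (lam, mu)
  (s := ((lam, mu), v) :: [seq (x.1, f x.2) | x <- s]).
  move=> y; rewrite inE => /orP[/eqP-> //|/mapP[x /hs[jx Qx] ->]].
  by have [] := hom_on_joint Qx jx.
exists (\sum_(x <- s | x.1 == (lam, mu)) x.2); rewrite big_seq_cond; split.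
- by apply: (sub_sum sQ) => x /andP[/hs[]].
- apply: joint_space_sum; first exact: act_linear.
  by move=> x /andP[/hs[jx _] /eqP e]; move: jx; rewrite e.
- rewrite (hom_on_sum sQ hf) => [|x /andP[/hs[]] //].
  have ev : v = \sum_(x <- s) f x.2.
    by rewrite -eu es big_seq (hom_on_sum sQ hf) -?big_seq // => x /hs[].
  have := hpq _ (mem_head _ _); rewrite eqxx /= {1}ev.
  rewrite (lin_sum (pev_linear (lN J 0) p)).
  rewrite (lin_sum (pev_linear (lN (voa_omega V) 1) q)) => <-.
  rewrite -big_seq_cond.
  rewrite [LHS]big_mkcond; apply: eq_big_seq => x xs.
  by rewrite (hpq (x.1, f x.2)) //= inE; apply/orP; right; apply/mapP; exists x.
Qed.

Fact image_finite lam mu : finite_dim (joint_space J N lam mu).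
Proof.
have [s hs] := gm_finite M lam mu.
have [||v [_ /hs] //|t [tW ht]] := @subspace_spanned _ _ s (Q `&` joint_space J M lam mu).
- by split; [apply: (sub0 sQ)|apply: joint_space0].
- move=> c u v [Qu ju] [Qv jv]; split; first exact: (subP sQ).
  by apply: joint_space_lin => //; apply: act_linear.
exists (map f t) => v /joint_space_lift[u [Qu ju <-]].
have tQ : {in t, forall x, Q x} by move=> y /tW[].
by have [] := in_span_map (sub0 sQ) (subP sQ) (hom_on0 sQ hf) hf.1 tQ
  (ht u (conj Qu ju)).
Qed.

Fact image_bounded lam mu : exists n0 : nat, forall n : nat, (n0 <= n)%N ->
  joint_space J N lam (mu - n%:R) `<=` [set 0].
Proof.
have [n0 h] := gm_bounded M lam mu; exists n0 => n /h hn v.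
move=> /joint_space_lift[u [Qu /hn -> <-]]; exact: (hom_on0 sQ hf).
Qed.

Definition image_gmodule : gmodule J := @GModule R V J N image_bilinear
  image_truncated image_vacuum image_borcherds image_graded image_finite
  image_bounded.
End TransferToQuotient.

(** Brings subquotients back into the graded category: the self-extensions of A to which [Ext1_zero]
    is applied and the module P_A itself arise here. *)
Lemma subquotient_exists (M : gmodule J) (K Q : set M) : submodule K ->
  submodule Q -> K `<=` Q -> exists N : gmodule J, subquotient_iso K Q N.
Proof.
move=> sK sQ KQ.
have [N isoN] := subquot_spaceP sK sQ KQ (act_linear M).
have /subquotient_isoP[_ _ _ [f [hf surj _]]] := isoN.
by exists (image_gmodule sQ hf surj).
Qed.

End GradedModules.
Arguments act_linear {R V J} M a n.

(** * Correspondences and the submodule lattice *)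

Section Correspondences.
Variables (R : realType) (V : voa R).
Implicit Types M N : mode_space V.

(* G is the graph of the map T -> N with kernel S. *)
Lemma subquotient_of_corr M N (G : set (dsum M N)) (S T : set M) :
  (forall a n, linear (act M a n)) ->
  submodule G -> (forall n, G (0, n) -> n = 0) -> (forall n, exists m, G (m, n)) ->
  (forall m, S m <-> G (m, 0)) -> (forall m, T m <-> exists n, G (m, n)) ->
  subquotient_iso S T N.
Proof.
move=> lM [G0 Gl Ga] Gf Gs hS hT; apply/subquotient_isoP.
have Guniq m n n' : G (m, n) -> G (m, n') -> n = n'.
  move=> g g'; have : G (- 1 *: m + m, - 1 *: n' + n) := Gl _ _ _ g' g.
  by rewrite !scaleN1r addNr => /Gf/eqP; rewrite addrC subr_eq0 => /eqP.
split.
- split=> [|c u v /hS gu /hS gv|a k u /hS gu]; apply/hS => //.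
  + by have : G (c *: u + v, c *: 0 + 0) := Gl _ _ _ gu gv; rewrite scaler0 addr0.
  + have g : G (act M a k u, act N a k 0) := Ga a k _ gu.
    have g0 : G (act M a k 0, act N a k 0) := Ga a k _ G0.
    by move: g0 g; rewrite (lin0 (lM a k)) => /Gf ->.
- split=> [|c u v /hT[m gm] /hT[n gn]|a k u /hT[n gn]]; apply/hT.
  + by exists 0.
  + by exists (c *: m + n); apply: Gl gm gn.
  + by exists (act N a k n); apply: Ga gn.
- by move=> u /hS gu; apply/hT; exists 0.
- exists (fun u => xget 0 [set n | G (u, n)]).
  have gP u n : G (u, n) -> xget 0 [set n | G (u, n)] = n.
    move=> g; apply: (Guniq u) => //.
    by have : [set n | G (u, n)] (xget 0 [set n | G (u, n)]) by apply: (xgetI 0 g).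
  split.
  + split=> [c u v /hT[m gm] /hT[n gn]|a k u /hT[n gn]].
      by rewrite (gP _ _ gm) (gP _ _ gn); apply: gP; apply: Gl gm gn.
    by rewrite (gP _ _ gn); apply: gP; apply: Ga gn.
  + move=> n; have [m g] := Gs n; exists m; first by apply/hT; exists n.
    exact: gP.
  + move=> u /hT[n gn]; rewrite (gP _ _ gn); split=> [e|/hS /gP <-].
      by apply/hS; rewrite -e.
    by rewrite (gP _ _ gn).
Qed.

Lemma isomorphic_of_corr M N (G : set (dsum M N)) :
  (forall a n, linear (act M a n)) ->
  submodule G -> (forall n, G (0, n) -> n = 0) -> (forall m, G (m, 0) -> m = 0) ->
  (forall n, exists m, G (m, n)) -> (forall m, exists n, G (m, n)) ->
  isomorphic M N.
Proof.
move=> lM sG Gf Gi Gs Gt.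
have h0 m : [set 0] m <-> G (m, 0) by split=> [->|/Gi //]; apply: (sub0 sG).
have hT m : setT m <-> exists n, G (m, n) by split=> // _; apply: Gt.
have /subquotient_isoP[_ _ _ [f [hf fs fk]]] := subquotient_of_corr lM sG Gf Gs h0 hT.
have lf : linear f by move=> c u v; apply: hf.1.
exists f; split; first by split=> // a n u; apply: hf.2.
have finj : injective f by apply: (lin_inj lf) => u /fk; apply.
pose g n := projT1 (cid2 (fs n)).
have fg n : f (g n) = n by rewrite /g; case: cid2.
by exists g => // u; apply: finj; rewrite fg.
Qed.

Lemma isomorphic_sym M N : isomorphic M N -> isomorphic N M.
Proof.
move=> [f [[lf af] [g fg gf]]]; exists g; split; last by exists f.
split=> [c u v|a n u]; apply: (can_inj fg).
  by rewrite lf !gf.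
by rewrite af !gf.
Qed.

Lemma submoduleI M (S T : set M) : submodule S -> submodule T ->
  submodule (S `&` T).
Proof.
move=> [S0 Sl Sa] [T0 Tl Ta]; split=> // [c u v [] su tu [] sv tv|a n u [] su tu].
  by split; [apply: Sl|apply: Tl].
by split; [apply: Sa|apply: Ta].
Qed.

Definition sub_add M (S T : set M) : set M :=
  [set u | exists s t, [/\ S s, T t & u = s + t]].

Lemma submodule_add M (S T : set M) : (forall a n, linear (act M a n)) ->
  submodule S -> submodule T -> submodule (sub_add S T).
Proof.
move=> lM sS sT; split.
- by exists 0, 0; rewrite addr0; split=> //; [apply: (sub0 sS)|apply: (sub0 sT)].
- move=> c _ _ [s [t [Ss Tt ->]]] [s' [t' [Ss' Tt' ->]]].
  exists (c *: s + s'), (c *: t + t'); rewrite scalerDr addrACA; split=> //.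
    exact: (subP sS).
  exact: (subP sT).
- move=> a n _ [s [t [Ss Tt ->]]]; exists (act M a n s), (act M a n t).
  by rewrite (linD (lM a n)); split=> //; [apply: (subact sS)|apply: (subact sT)].
Qed.

Lemma sub_addl M (S T : set M) : submodule T -> S `<=` sub_add S T.
Proof. by move=> sT u Su; exists u, 0; rewrite addr0; split=> //; apply: (sub0 sT). Qed.
Lemma sub_addr M (S T : set M) : submodule S -> T `<=` sub_add S T.
Proof. by move=> sS u Tu; exists 0, u; rewrite add0r; split=> //; apply: (sub0 sS). Qed.
Lemma sub_add_subset M (S T W : set M) : submodule W -> S `<=` W -> T `<=` W ->
  sub_add S T `<=` W.
Proof. by move=> sW SW TW _ [s [t [/SW Ws /TW Wt ->]]]; apply: (subD sW). Qed.

Lemma simple_subquotient M (S T W : set M) N : simple_module N ->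
  subquotient_iso S T N -> submodule W -> S `<=` W -> W `<=` T ->
  W `<=` S \/ T `<=` W.
Proof.
move=> [_ simN] /subquotient_isoP[sS sT ST [f [hf fs fk]]] sW SW WT.
have sfW : submodule [set f u | u in W].
  split.
  - by exists 0; [apply: (sub0 sW)|apply: hom_on0 hf].
  - move=> c _ _ [u Wu <-] [v Wv <-]; exists (c *: u + v); first exact: (subP sW).
    by rewrite hf.1 //; apply: WT.
  - move=> a n _ [u Wu <-]; exists (act M a n u); first exact: (subact sW).
    by rewrite hf.2 //; apply: WT.
case: (simN _ sfW) => e; [left=> u Wu|right=> u Tu].
  apply/fk; first exact: WT.
  have : [set f v | v in W] (f u) by exists u.
  by rewrite e.
have : [set f u | u in W] (f u) by rewrite e.
move=> [v Wv fe]; rewrite -(subrK v u); apply: (subD sW) => //; apply: SW.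
apply/fk; first by apply: (subB sT) => //; apply: WT.
by rewrite (hom_onB sT hf) ?fe ?subrr //; apply: WT.
Qed.

Lemma simple_subquotient_neq M (S T : set M) N : simple_module N ->
  subquotient_iso S T N -> ~ T `<=` S.
Proof.
move=> [[w w0] _] [_ _ _ [f [_ _ fs fk]]] TS.
have [u Tu fu] := fs w; have := TS u Tu; move/(fk u Tu).
by rewrite fu => e; move: w0; rewrite e eqxx.
Qed.

(** U / S has length two and T / S is its only proper nonzero submodule: if [W] meets [T] in [S]
    only, then either [W] lies in [T] or W + T = U, and in the latter case [W] would be a
    complement. *)
Lemma arrow_uniserial M (S T U W : set M) X Y :
  (forall a n, linear (act M a n)) -> simple_module X -> simple_module Y ->
  arrow S T U X Y -> submodule W -> S `<=` W -> W `<=` U ->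
  (W `<=` T \/ U `<=` W) /\ (W `<=` S \/ T `<=` W).
Proof.
move=> lM simX simY [iY iX ns] sW SW WU.
have [sS sT ST _] := iY; have [_ sU TU _] := iX.
have hI : W `<=` T -> W `<=` S \/ T `<=` W.
  by move=> WT; apply: (simple_subquotient simY iY).
have [WTS|TWT] : W `&` T `<=` S \/ T `<=` W `&` T.
  apply: (simple_subquotient simY iY) => [|u Su|u []//].
    exact: submoduleI.
  by split; [apply: SW|apply: ST].
- have [h|h] : sub_add W T `<=` T \/ U `<=` sub_add W T.
    apply: (simple_subquotient simX iX); [exact: submodule_add|exact: sub_addr|].
    exact: sub_add_subset.
  + have WT : W `<=` T by move=> u Wu; apply: h; apply: sub_addl.
    by split; [left|apply: hI].
  + case: ns; exists W; split=> //; apply/seteqP; split=> // u Su.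
    by split; [apply: SW|apply: ST].
- have TW : T `<=` W by move=> u /TWT[].
  split; last by right.
  have [h|h] := simple_subquotient simX iX sW TW WU; by [left|right].
Qed.

(** Goursat's argument: the image of [W] in T / F x T / X is the graph of an isomorphism. It turns a
    diagonal submodule of B + C into an isomorphism of B with C. *)
Lemma isomorphic_subquotients M (F X T W : set M) B C :
  (forall a n, linear (act B a n)) ->
  subquotient_iso F T B -> subquotient_iso X T C ->
  submodule W -> W `<=` T -> W `&` F `<=` X -> W `&` X `<=` F ->
  T `<=` sub_add W F -> T `<=` sub_add W X -> isomorphic B C.
Proof.
move=> lB /subquotient_isoP[sF sT FT [f [hf fs fk]]].
move=> /subquotient_isoP[sX _ XT [g [hg gs gk]]] sW WT WF WX TF TX.
apply: (@isomorphic_of_corr B C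
  [set x : dsum B C | exists w, [/\ W w, f w = x.1 & g w = x.2]]).
- exact: lB.
- split.
  + exists 0; split; [exact: (sub0 sW)|exact: hom_on0 hf|exact: hom_on0 hg].
  + move=> c [b1 c1] [b2 c2] [u [Wu /= <- <-]] [v [Wv /= <- <-]]; exists (c *: u + v).
    split; first exact: (subP sW).
      by rewrite hf.1 //; apply: WT.
    by rewrite hg.1 //; apply: WT.
  + move=> a n [b c] [u [Wu /= <- <-]]; exists (act M a n u).
    split; first exact: (subact sW).
      by rewrite hf.2 //; apply: WT.
    by rewrite hg.2 //; apply: WT.
- move=> n [w [Ww /= fw <-]]; apply/gk; first exact: WT.
  by apply: WF; split=> //; apply/fk => //; apply: WT.
- move=> m [w [Ww /= <- gw]]; apply/fk; first exact: WT.
  by apply: WX; split=> //; apply/gk => //; apply: WT.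
- move=> n; have [u Tu <-] := gs n; have [w [x [Ww Xx ->]]] := TX _ Tu.
  have [Tw Tx] := (WT _ Ww, XT _ Xx).
  exists (f w), w; split=> //=.
  by rewrite (hom_onD hg Tw Tx) (gk x Tx).2 ?addr0.
- move=> n; have [u Tu <-] := fs n; have [w [x [Ww Xx ->]]] := TF _ Tu.
  have [Tw Tx] := (WT _ Ww, FT _ Xx).
  exists (g w), w; split=> //=.
  by rewrite (hom_onD hf Tw Tx) (fk x Tx).2 ?addr0.
Qed.

End Correspondences.

(** * The Loewy diagram forced by four non-split arrows *)

Section Diamond.
Variables (R : realType) (V : voa R) (P A B C : mode_space V).
Variables (S F X T : set P).
Hypotheses (lP : forall a n, linear (act P a n)).
Hypotheses (lB : forall a n, linear (act B a n)).
Hypotheses (sA : simple_module A) (sB : simple_module B) (sC : simple_module C).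
Hypothesis nBC : ~ isomorphic B C.
Hypotheses (FXS : F `&` X `<=` S) (FXT : T `<=` sub_add F X).
Hypotheses (TB : arrow F T setT A B) (TC : arrow X T setT A C).
Hypotheses (BS : arrow [set 0] S X B A) (CS : arrow [set 0] S F C A).

Let isoB : subquotient_iso F T B. Proof. by case: TB. Qed.
Let isoC : subquotient_iso X T C. Proof. by case: TC. Qed.
Let isoSX : subquotient_iso S X B. Proof. by case: BS. Qed.
Let isoSF : subquotient_iso S F C. Proof. by case: CS. Qed.
Let isoS : subquotient_iso [set 0] S A. Proof. by case: CS. Qed.
Let isoT : subquotient_iso T setT A. Proof. by case: TB. Qed.
Let sS : submodule S. Proof. by case: isoSX. Qed.
Let sX : submodule X. Proof. by case: isoSX. Qed.
Let sF : submodule F. Proof. by case: isoSF. Qed.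
Let sT : submodule T. Proof. by case: isoB. Qed.
Let FT : F `<=` T. Proof. by case: isoB. Qed.
Let XT : X `<=` T. Proof. by case: isoC. Qed.
Let SF : S `<=` F. Proof. by case: isoSF. Qed.
Let SX : S `<=` X. Proof. by case: isoSX. Qed.

(** By the arrows into the bottom, a [W] not containing [S] meets [F] and [X] in 0, so W /\ T embeds
    into both T / F = B and T / X = C. If it is nonzero it maps onto both, and B and C are
    isomorphic. If it is zero and [W] is not, then [W] is a complement that splits the arrow from A
    to B. *)
Lemma diamond_bottom W : submodule W -> W `<=` [set 0] \/ S `<=` W.
Proof.
move=> sW; have z (U : set P) : submodule U -> [set 0] `<=` U by move=> sU _ ->; apply: sub0 sU.
have sub_inter (U : set P) (C' : mode_space V) : simple_module C' -> arrow [set 0] S U C' A -> submodule U ->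
    W `&` U `<=` [set 0] \/ S `<=` W.
  move=> sC' ar sU; have sWU := submoduleI sW sU.
  have [_ [h|h]] := arrow_uniserial lP sC' sA ar sWU (z _ sWU) (fun u => @proj2 _ _).
    by left.
  by right=> u /h[].
have [WF|] := sub_inter _ _ sC CS sF; last by right.
have [WX|] := sub_inter _ _ sB BS sX; last by right.
have sWT := submoduleI sW sT.
have gen (U : set P) (N : mode_space V) : simple_module N -> subquotient_iso U T N ->
    W `&` U `<=` [set 0] -> W `&` T `<=` [set 0] \/ T `<=` sub_add (W `&` T) U.
  move=> simN iN WU; have [sU _ UT _] := iN.
  have [h|h] : sub_add (W `&` T) U `<=` U \/ T `<=` sub_add (W `&` T) U.
    apply: (simple_subquotient simN iN); [exact: submodule_add|exact: sub_addr|].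
    by apply: sub_add_subset => // u [].
  - left=> u WTu; apply: WU; split; first by case: WTu.
    by apply: h; apply: sub_addl.
  - by right.
have [WT0|TF] := gen _ _ sB isoB WF; last first.
  have [WT0|TX] := gen _ _ sC isoC WX; last first.
    case: nBC; apply: (isomorphic_subquotients lB isoB isoC sWT _ _ _ TF TX).
    + exact: subIsetr.
    + by move=> u [[Wu _] Fu]; have -> := WF u (conj Wu Fu); apply: sub0 sX.
    + by move=> u [[Wu _] Xu]; have -> := WX u (conj Wu Xu); apply: sub0 sF.
  case: (simple_subquotient_neq sB isoB) => u /TF[w [v [/WT0 -> Fv ->]]].
  by rewrite add0r.
have [||[h|h] _] := arrow_uniserial lP sA sB TB (submodule_add lP sW sF).
- exact: sub_addr.
- by [].
- by left=> u Wu; apply: WT0; split=> //; apply: h; apply: sub_addl.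
- case: (simple_subquotient_neq sB isoB) => u Tu.
  have [w [v [Ww Fv e]]] := h u I.
  suff -> : u = v by [].
  rewrite e (WT0 w) ?add0r //; split=> //.
  by rewrite -(addrK v w) -e; apply: (subB sT) => //; apply: FT.
Qed.

(** Dual to [diamond_bottom]. By the arrows from the top, a [W] not contained in [T] satisfies W + F
    = W + X = P. Then (W /\ T) + S is all of [T], for otherwise it would be diagonal in T / S and
    make B and C isomorphic. So W + S = P, and [S] is absorbed by the arrow from C to the bottom. *)
Lemma diamond_top W : submodule W -> W `<=` T \/ [set: P] `<=` W.
Proof.
move=> sW; have [|nWT] := pselect (W `<=` T); first by left.
right.
have gen (U : set P) (N : mode_space V) : simple_module N -> arrow U T setT A N -> [set: P] `<=` sub_add W U.
  move=> simN ar; have [[sU _ UT _] _ _] := ar.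
  have [||[h|//] _] := arrow_uniserial lP sA simN ar (submodule_add lP sW sU) => //.
    exact: sub_addr.
  by case: nWT => u Wu; apply: h; apply: sub_addl.
have PF := gen _ _ sB TB; have PX := gen _ _ sC TC.
have sWT := submoduleI sW sT.
(* Adding [S] makes the simplicity of F / S and X / S applicable to the intersections with [F] and
   [X]. *)
pose W' := sub_add (W `&` T) S.
have sW' : submodule W' by apply: submodule_add.
have SW' : S `<=` W' by apply: sub_addr.
have W'T : W' `<=` T.
  by apply: sub_add_subset => // u /SF/FT.
have modular (U : set P) : U `<=` T -> [set: P] `<=` sub_add W U -> submodule U ->
    T `<=` sub_add W' U.
  move=> UT PU sU u Tu; have [w [v [Ww Uv e]]] := PU u I.
  exists w, v; split=> //; apply: sub_addl => //; split=> //.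
  by rewrite -(addrK v w) -e; apply: (subB sT) => //; apply: UT.
have TF := modular _ FT PF sF; have TX := modular _ XT PX sX.
have TW' : T `<=` W'.
  have full (U : set P) : T `<=` sub_add W' U -> U `<=` W' -> T `<=` W'.
    by move=> TU UW u /TU[w [v [Ww /UW Wv ->]]]; apply: (subD sW').
  have [WF|FW] : W' `&` F `<=` S \/ F `<=` W' `&` F.
  - apply: (simple_subquotient sC isoSF); [exact: submoduleI| |by move=> u []].
    by move=> u Su; split; [apply: SW'|apply: SF].
  - have [WX|XW] : W' `&` X `<=` S \/ X `<=` W' `&` X.
    + apply: (simple_subquotient sB isoSX); [exact: submoduleI| |by move=> u []].
      by move=> u Su; split; [apply: SW'|apply: SX].
    + case: nBC; apply: (isomorphic_subquotients lB isoB isoC sW' W'T _ _ TF TX).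
        by move=> u /WF/SX.
      by move=> u /WX/SF.
    + by apply: full TX _ => u /XW[].
  - by apply: full TF _ => u /FW[].
have PS : [set: P] `<=` sub_add W S.
  move=> u _; have [w [v [Ww Fv ->]]] := PF u I.
  have [w' [s [[Ww' _] Ss ->]]] := TW' v (FT Fv).
  by exists (w + w'), s; rewrite addrA; split=> //; apply: (subD sW).
(* From W + S = P follows F = (W /\ F) + S. As [F] is uniserial and S is proper in it, W /\ F must
   be all of [F], and then P = W + F = W. *)
have sWF := submoduleI sW sF.
have [||[h|h] _] := arrow_uniserial lP sC sA CS sWF.
- by move=> _ ->; apply: sub0 sWF.
- by move=> u [].
- case: (simple_subquotient_neq sC isoSF) => u Fu.
  have [w [s [Ww Ss e]]] := PS u I.
  rewrite e; apply: (subD sS) => //; apply: h; split=> //.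
  by rewrite -(addrK s w) -e; apply: (subB sF) => //; apply: SF.
- move=> u _; have [w [v [Ww /h[Wv _] ->]]] := PF u I; exact: (subD sW).
Qed.

Let S_neq0 : S <> [set 0].
Proof. by move=> e; apply: (simple_subquotient_neq sA isoS); rewrite e. Qed.

Let z_sub (W : set P) : submodule W -> [set 0] `<=` W.
Proof. by move=> sW _ ->; apply: sub0 sW. Qed.

Lemma diamond_indecomposable : indecomposable P.
Proof.
have [w Sw w0] : exists2 w, S w & w != 0.
  apply: contrapT => no; apply: S_neq0; apply/seteqP; split=> [u Su|].
    by apply: contrapT => /eqP u0; apply: no; exists u.
  exact: z_sub.
split; first by exists w.
move=> W W' sW sW' WW' _.
have [h|h] := diamond_bottom sW; first by left; apply/seteqP; split=> //; apply: z_sub.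
have [h'|h'] := diamond_bottom sW'; first by right; apply/seteqP; split=> //; apply: z_sub.
have : (W `&` W') w by split; [apply: h|apply: h'].
by rewrite WW' => e; move: w0; rewrite e eqxx.
Qed.

Let S_simple : simple_submodule S.
Proof.
split=> // W sW WS.
have [h|h] := simple_subquotient sA isoS sW (z_sub sW) WS; [left|right]; apply/seteqP.
  by split=> //; apply: z_sub.
by split.
Qed.

Let T_neq : T <> [set: P].
Proof. by move=> e; apply: (simple_subquotient_neq sA isoT); rewrite e. Qed.

Lemma diamond_socle : socle P = S.
Proof.
apply/seteqP; split=> [u hu|u Su W sW h]; last exact: (h _ S_simple).
apply: hu => // W [sW W0 hW].
have [h|SW] := diamond_bottom sW.
  by case: W0; apply/seteqP; split=> //; apply: z_sub.
by case: (hW _ sS SW) => // <-.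
Qed.

Lemma diamond_radical : radical P = T.
Proof.
have maxT : maximal_submodule T.
  split=> // W sW TW.
  have [h|h] := diamond_top sW; [left|right]; apply/seteqP; by split.
apply/seteqP; split=> [u|u Tu W [sW WP hW]]; first exact.
have [h|h] := diamond_top sW; last by case: WP; apply/seteqP; split.
by case: (hW _ sT h) => e; [rewrite -e|case: T_neq].
Qed.

Lemma diamond_loewy : loewy_diamond P A B C A.
Proof.
rewrite /loewy_diamond diamond_socle diamond_radical; split; split=> //.
- apply/subquotient_isoP; split=> //; first by move=> u /SF/FT.
  have /subquotient_isoP[_ _ _ [f [hf fs fk]]] := isoB.
  have /subquotient_isoP[_ _ _ [g [hg gs gk]]] := isoC.
  exists (fun u => (f u, g u)); split.
  + split=> [c u v Tu Tv|a n u Tu]; first by rewrite hf.1 // hg.1.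
    by rewrite hf.2 // hg.2.
  + move=> [b c].
    have [u Tu fu] := fs b; have [v Tv gv] := gs c.
    have [f1 [x1 [Ff1 Xx1 eu]]] := FXT Tu.
    have [f2 [x2 [Ff2 Xx2 ev]]] := FXT Tv.
    have [Tf1 Tf2] := (FT Ff1, FT Ff2); have [Tx1 Tx2] := (XT Xx1, XT Xx2).
    (* [f] vanishes on [F] and [g] on [X], so the [X]-part of a lift of [b] and the [F]-part of a
       lift of [c] do not disturb each other. *)
    exists (x1 + f2); first exact: (subD sT).
    rewrite (hom_onD hf) // (hom_onD hg) //.
    have -> : f f2 = 0 by apply/fk.
    have -> : g x1 = 0 by apply/gk.
    rewrite addr0 add0r; congr (_, _).
      by rewrite -fu eu (hom_onD hf) // (_ : f f1 = 0) ?add0r //; apply/fk.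
    by rewrite -gv ev (hom_onD hg) // (_ : g x2 = 0) ?addr0 //; apply/gk.
  + move=> u Tu; split=> [[/(fk _ Tu) Fu /(gk _ Tu) Xu]|Su]; first exact: FXS.
    have -> : f u = 0 by apply/fk => //; apply: SF.
    by have -> : g u = 0 by apply/gk => //; apply: SX.
- by exists F.
- by exists X.
- by exists X.
- by exists F.
Qed.

End Diamond.

(** * Direct sums *)

Section DirectSum.
Variables (R : realType) (V : voa R) (J : V) (M N : gmodule J).

Let D := dsum M N.

Lemma dsum_sum (I : Type) (r : seq I) (P : pred I) (G : I -> D) :
  \sum_(i <- r | P i) G i =
  (\sum_(i <- r | P i) (G i).1, \sum_(i <- r | P i) (G i).2).
Proof.
apply: (big_ind3 (fun (x : D) (y : M) (z : N) => x = (y, z))) => //.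
  by move=> _ y z _ y' z' -> ->.
by move=> i _; rewrite -surjective_pairing.
Qed.

Lemma shift_iter_dsum a n lam k (u : D) :
  shift_iter (act D a n) lam k u =
  (shift_iter (act M a n) lam k u.1, shift_iter (act N a n) lam k u.2).
Proof.
case: u => x y; rewrite /shift_iter; elim: k => [//|k IH].
by rewrite !iterS IH.
Qed.

Fact dsum_bilinear : bilinear_modes (act D).
Proof.
have [m1 m2] := gm_bilinear M; have [n1 n2] := gm_bilinear N.
split=> [n u c a b|a n c u v] /=; first by rewrite m1 n1.
by rewrite m2 n2.
Qed.

Fact dsum_truncated : lower_truncated (act D).
Proof.
move=> a u; have [k hk] := gm_truncated (g := M) a u.1.
have [l hl] := gm_truncated (g := N) a u.2; exists (Num.max k l) => n.
by rewrite ge_max => /andP[/hk /= -> /hl ->].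
Qed.

Fact dsum_vacuum : vacuum_acts (voa_vac V) (act D).
Proof.
move=> n [x y] /=; rewrite (gm_vacuum (g := M)) (gm_vacuum (g := N)).
by case: eqP.
Qed.

Fact dsum_borcherds : borcherds (@voa_mode R V) (act D).
Proof.
move=> a b u m n k; have [p hp] := gm_borcherds (g := M) a b u.1 m n k.
have [q hq] := gm_borcherds (g := N) a b u.2 m n k; exists (maxn p q) => l.
by rewrite geq_max => /andP[/hp ep /hq eq]; rewrite !dsum_sum ep eq.
Qed.

Lemma joint_space_dsum lam mu (u : D) : joint_space J D lam mu u <->
  joint_space J M lam mu u.1 /\ joint_space J N lam mu u.2.
Proof.
have pair (E : gmodule J) a n c (x : E) k l : (k <= l)%N ->
    shift_iter (act E a n) c k x = 0 -> shift_iter (act E a n) c l x = 0.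
  by move=> kl; apply: shift_iter_widen => //; apply: act_linear.
have gen a n c : gen_eigenspace (act D a n) c u <->
    gen_eigenspace (act M a n) c u.1 /\ gen_eigenspace (act N a n) c u.2.
  split=> [[k]|[[k hk] [l hl]]].
    by rewrite shift_iter_dsum => -[h1 h2]; split; exists k.
  exists (maxn k l); rewrite shift_iter_dsum.
  by rewrite (pair _ _ _ _ _ _ _ (leq_maxl k l) hk) (pair _ _ _ _ _ _ _ (leq_maxr k l) hl).
split=> [[/gen[? ?] /gen[? ?]]|[[h1 h2] [h3 h4]]]; first by [].
by split; apply/gen.
Qed.

Fact dsum_graded : sums_of [set v | exists lam mu, joint_space J D lam mu v].
Proof.
move=> [x y]; have [s [hs ->]] := gm_graded (g := M) x.
have [t [ht ->]] := gm_graded (g := N) y.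
exists ([seq (a, 0) | a <- s] ++ [seq (0, b) | b <- t]); split.
  move=> z; rewrite mem_cat => /orP[] /mapP[a].
    move=> /hs[lam [mu h]] ->; exists lam, mu; apply/joint_space_dsum; split=> //.
    exact: joint_space0.
  move=> /ht[lam [mu h]] ->; exists lam, mu; apply/joint_space_dsum; split=> //.
  exact: joint_space0.
rewrite big_cat !big_map !dsum_sum /= !big1_eq.
by apply: injective_projections; rewrite /= ?addr0 ?add0r.
Qed.

Fact dsum_finite lam mu : finite_dim (joint_space J D lam mu).
Proof.
have [s hs] := gm_finite M lam mu; have [t ht] := gm_finite N lam mu.
exists ([seq (a, 0) | a <- s] ++ [seq (0, b) | b <- t]) => -[x y].
move=> /joint_space_dsum[/hs hx /ht hy].
have lx c (u v : M) : setT u -> setT v ->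
    (c *: u + v, 0) = c *: ((u, 0) : D) + (v, 0).
  by move=> _ _; apply: injective_projections; rewrite //= scaler0 addr0.
have ly c (u v : N) : setT u -> setT v ->
    (0, c *: u + v) = c *: ((0, u) : D) + (0, v).
  by move=> _ _; apply: injective_projections; rewrite //= scaler0 addr0.
have [_ h1] := in_span_map (Q := setT) (f := fun a => (a, 0) : D)
  I (fun _ _ _ _ _ => I) erefl lx (fun _ _ => I) hx.
have [_ h2] := in_span_map (Q := setT) (f := fun b => (0, b) : D)
  I (fun _ _ _ _ _ => I) erefl ly (fun _ _ => I) hy.
have -> : (x, y) = 1 *: ((x, 0) : D) + (0, y).
  by rewrite scale1r; apply: injective_projections; rewrite /= ?addr0 ?add0r.
by apply: in_span_lin; [apply: in_span_catl|apply: in_span_catr].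
Qed.

Fact dsum_bounded lam mu : exists n0 : nat, forall n : nat, (n0 <= n)%N ->
  joint_space J D lam (mu - n%:R) `<=` [set 0].
Proof.
have [k hk] := gm_bounded M lam mu; have [l hl] := gm_bounded N lam mu.
exists (maxn k l) => n; rewrite geq_max => /andP[/hk h1 /hl h2] [x y].
by move=> /joint_space_dsum[/h1 /= -> /h2 /= ->].
Qed.

Definition dsum_gmodule : gmodule J := @GModule R V J D dsum_bilinear
  dsum_truncated dsum_vacuum dsum_borcherds dsum_graded dsum_finite dsum_bounded.
End DirectSum.

(** * Extensions *)

Section ImagesOfSubquotients.
Variables (R : realType) (V : voa R) (M N : mode_space V) (K Q : set M).
Variable f : M -> N.
Hypotheses (lN : forall a n, linear (act N a n)) (sQ : submodule Q).
Hypotheses (sK : submodule K) (hf : hom_on Q f).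
Hypothesis fs : forall w, exists2 u, Q u & f u = w.
Hypothesis fk : forall u, Q u -> (f u = 0 <-> K u).

Lemma image_memE (S : set M) u : submodule S -> K `<=` S -> S `<=` Q -> Q u ->
  (f @` S) (f u) <-> S u.
Proof.
move=> sS KS SQ Qu; split=> [[v Sv e]|Su]; last by exists u.
rewrite -(subrK v u); apply: (subD sS) => //; apply: KS; apply/fk.
  by apply: (subB sQ) => //; apply: SQ.
by rewrite (hom_onB sQ hf) ?e ?subrr //; apply: SQ.
Qed.

Lemma image_subquotient (S T : set M) X : K `<=` S -> T `<=` Q ->
  subquotient_iso S T X -> subquotient_iso (f @` S) (f @` T) X.
Proof.
move=> KS TQ /subquotient_isoP[sS sT ST [g [hg gs gk]]].
apply: (@subquotient_of_corr R V N X [set x | exists u, [/\ T u, f u = x.1 & g u = x.2]]).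
- exact: lN.
- split.
  + exists 0; split; [exact: (sub0 sT)|exact: hom_on0 hf|exact: hom_on0 hg].
  + move=> c [b1 c1] [b2 c2] [u [Tu /= <- <-]] [v [Tv /= <- <-]].
    exists (c *: u + v); rewrite hf.1 ?hg.1 //; try exact: TQ.
    by split=> //; apply: (subP sT).
  + move=> a n [b c] [u [Tu /= <- <-]]; exists (act M a n u).
    by rewrite hf.2 ?hg.2 //; [split=> //; apply: (subact sT)|apply: TQ].
- move=> x [u [Tu /= fu <-]]; apply/gk => //; apply: KS.
  by apply/fk => //; apply: TQ.
- by move=> x; have [u Tu <-] := gs x; exists (f u), u.
- move=> v; split=> [[u Su <-]|[u [Tu /= <- gu]]].
    by exists u; split=> //=; [apply: ST|apply/gk => //; apply: ST].
  by exists u => //; apply/gk.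
- move=> v; split=> [[u Tu <-]|[x [u [Tu /= <- _]]]]; last by exists u.
  by exists (g u), u.
Qed.

(** A complement in the quotient by [K] pulls back to a complement upstairs. Thus the arrows of P_A
    can be checked inside the direct sum of E_B^(2) and F_C^(2). *)
Lemma image_arrow (S T U : set M) X Y : K `<=` S -> U `<=` Q ->
  arrow S T U X Y -> arrow (f @` S) (f @` T) (f @` U) X Y.
Proof.
move=> KS UQ [iY iX ns]; have [sS sT ST _] := iY; have [_ sU TU _] := iX.
have TQ : T `<=` Q by move=> u /TU/UQ.
have KT : K `<=` T by move=> u /KS/ST.
split; [exact: image_subquotient|exact: image_subquotient|].
move=> [W [sW WU WT UWT]]; apply: ns.
have WS u : Q u -> W (f u) -> T u -> S u.
  move=> Qu Wu Tu; apply/(image_memE sS) => //; first by move=> v /ST/TQ.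
  by rewrite -WT; split=> //; exists u.
exists [set u | U u /\ W (f u)]; split.
- split.
  + by split; [apply: (sub0 sU)|rewrite (hom_on0 sQ hf); apply: (sub0 sW)].
  + move=> c u v [Uu Wu] [Uv Wv]; split; first exact: (subP sU).
    by rewrite hf.1; [apply: (subP sW)|apply: UQ|apply: UQ].
  + move=> a n u [Uu Wu]; split; first exact: (subact sU).
    by rewrite hf.2; [apply: (subact sW)|apply: UQ].
- by move=> u [].
- apply/seteqP; split=> [u [[Uu Wu] Tu]|u Su]; first by apply: WS => //; apply: UQ.
  have Tu := ST _ Su; split=> //; split; first exact: TU.
  by have : (f @` S) (f u) by [exists u]; rewrite -WT => -[].
- move=> u Uu; have [|w [_ [Ww [t Tt <-] e]]] := UWT (f u); first by exists u.
  exists (u - t), t; rewrite subrK; split=> //; split.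
    by apply: (subB sU) => //; apply: TU.
  by rewrite (hom_onB sQ hf) ?e ?addrK //; [apply: UQ|apply: TQ].
Qed.

Lemma image_kernel : K `<=` Q -> f @` K = [set 0].
Proof.
move=> KQ; apply/seteqP; split=> [_ [u Ku <-]|_ ->].
  by apply/fk => //; apply: KQ.
by exists 0; [apply: (sub0 sK)|apply: hom_on0 hf].
Qed.

Lemma image_full : f @` Q = setT.
Proof. by apply/seteqP; split=> // w _; have [u] := fs w; exists u. Qed.

End ImagesOfSubquotients.

Section Extensions.
Variables (R : realType) (V : voa R) (M E N : mode_space V).
Hypothesis lE : forall a n, linear (act E a n).
Variables (i : M -> E) (p : E -> N).
Hypothesis ex : short_exact i p.

Lemma short_exact_sub : subquotient_iso [set 0] (range i) M.
Proof.
have [[li ai] [lp ap] injI surjp kerp] := ex.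
apply: (@subquotient_of_corr _ _ _ _ [set x : dsum E M | x.1 = i x.2]) => //.
- split=> [|c [a b] [d e] /= -> ->|a n [b c] /= ->].
  + by rewrite /= lin0.
  + by rewrite -li.
  + by rewrite ai.
- by move=> n /=; rewrite -(lin0 li) => /injI.
- by move=> m; exists (i m).
- by move=> m /=; rewrite lin0.
- by move=> m; split=> [[n _ <-]|[n /= ->]]; exists n.
Qed.

Lemma short_exact_quo : subquotient_iso (range i) setT N.
Proof.
have [[li ai] [lp ap] injI surjp kerp] := ex.
apply: (@subquotient_of_corr _ _ _ _ [set x : dsum E N | p x.1 = x.2]) => //.
- split=> [|c [a b] [d e] /= <- <-|a n [b c] /= <-].
  + by rewrite /= lin0.
  + by rewrite -lp.
  + by rewrite ap.
- by move=> n /=; rewrite lin0.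
- move=> m /=; split=> [[x _ <-]|/kerp[x <-]]; last by exists x.
  by apply/kerp; exists x.
- by move=> m; split=> // _; exists (p m).
Qed.

(** A complement of [range i] maps bijectively to [N], and the inverse of this map would be a
    section of [p]. *)
Lemma nonsplit_arrow : ~ split_extension i p -> arrow [set 0] (range i) setT N M.
Proof.
move=> ns; split; [exact: short_exact_sub|exact: short_exact_quo|].
have [[li ai] [lp ap] injI surjp kerp] := ex.
move=> [W [sW _ Wi Wall]]; apply: ns.
have ps n : exists2 w, W w & p w = n.
  have [u <-] := surjp n; have [w [t [Ww [m _ <-] e]]] := Wall u I.
  by exists w => //; rewrite e (linD lp) (kerp (i m)).2 ?addr0 //; exists m.
have uniq w w' : W w -> W w' -> p w = p w' -> w = w'.
  move=> Ww Ww' e; apply/eqP; rewrite -subr_eq0; apply/eqP.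
  suff : (W `&` range i) (w - w') by rewrite Wi.
  split; first exact: (subB sW).
  have /kerp[m em] : p (w - w') = 0 by rewrite (linB lp) e subrr.
  by exists m.
pose s n := projT1 (cid2 (ps n)).
have Ws n : W (s n) by rewrite /s; case: cid2.
have pK n : p (s n) = n by rewrite /s; case: cid2.
exists s; split=> //; split=> [c u v|a n u]; apply: uniq => //.
- exact: (subP sW).
- by rewrite lp !pK.
- exact: (subact sW).
- by rewrite ap !pK.
Qed.

End Extensions.

(** Converts a two-step filtration into the form in which [Ext1_zero] can be used; [i] is the
    inverse of the given map S -> M. *)
Lemma short_exact_of_subquotients (R : realType) (V : voa R)
    (M E N : mode_space V) (S : set E) :
  subquotient_iso [set 0] S M -> subquotient_iso S setT N ->
  exists (i : M -> E) (p : E -> N), short_exact i p.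
Proof.
move=> /subquotient_isoP[_ sS _ [g [hg gs gk]]].
move=> /subquotient_isoP[_ _ _ [p [hp ps pk]]].
have ginj u v : S u -> S v -> g u = g v -> u = v.
  move=> Su Sv e; apply/eqP; rewrite -subr_eq0; apply/eqP.
  apply/(gk (u - v)); first exact: (subB sS).
  by rewrite (hom_onB sS hg) // e subrr.
pose i m := projT1 (cid2 (gs m)).
have Si m : S (i m) by rewrite /i; case: cid2.
have gi m : g (i m) = m by rewrite /i; case: cid2.
exists i, p; split.
- split=> [c u v|a n u]; apply: ginj => //.
  + exact: (subP sS).
  + by rewrite hg.1 ?gi.
  + exact: (subact sS).
  + by rewrite hg.2 ?gi.
- by split=> [c u v|a n u]; [apply: hp.1|apply: hp.2].
- exact: can_inj gi.
- by move=> w; have [u _ e] := ps w; exists u.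
- move=> u; split=> [/(pk u I) Su|[m <-]]; last exact/(pk _ I).
  by exists (g u); apply: ginj => //; rewrite gi.
Qed.

(** * Monodromy *)

Section Monodromy.
Variables (R : realType) (V : voa R) (J : V) (h : R[i]).
Implicit Types M N E : gmodule J.

Let c0 : R[i] := cexp (two_pi_i R * h).

Definition two_pi_i_J0 (M : mode_space V) (u : M) : M := two_pi_i R *: J0 J u.

Lemma two_pi_i_J0_linear M : linear (@two_pi_i_J0 M).
Proof.
move=> c u v; rewrite /two_pi_i_J0 /J0 (act_linear M J 0) scalerDr !scalerA.
by rewrite mulrC.
Qed.

Arguments two_pi_i_J0_linear : clear implicits.

Lemma two_pi_i_J0_sub (M : mode_space V) (S : set M) u : submodule S -> S u ->
  S (two_pi_i_J0 u).
Proof. by move=> sS Su; apply: (subZ sS); apply: (subact sS). Qed.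

Lemma two_pi_i_J0_hom (M N : mode_space V) (Q : set M) (f : M -> N) u :
  submodule Q -> hom_on Q f -> Q u ->
  f (two_pi_i_J0 u) = two_pi_i_J0 (f u).
Proof.
move=> sQ hf Qu; rewrite /two_pi_i_J0 (hom_onZ sQ hf) ?hf.2 //.
exact: (subact sQ).
Qed.

Definition gen_vector (M : mode_space V) lam k (u : M) :=
  shift_iter (@two_pi_i_J0 M) lam k u = 0.

(* exp(2 pi i J_0) = e^(2 pi i h) (Id + pi), in a form that does not presuppose
   that the exponential exists as an operator on M. *)
Definition monodromy (M : mode_space V) (pi : M -> M) : Prop :=
  forall lam k (u : M), gen_vector lam k u ->
    expsum (@two_pi_i_J0 M) lam k u = c0 *: (u + pi u).

Lemma expsum_hom (M N : mode_space V) (Q : set M) (f : M -> N) lam k u :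
  submodule Q -> hom_on Q f -> Q u ->
  Q (expsum (@two_pi_i_J0 M) lam k u) /\
  f (expsum (@two_pi_i_J0 M) lam k u) = expsum (@two_pi_i_J0 N) lam k (f u).
Proof.
move=> sQ hf Qu; apply: expsum_commute => //.
- exact: (sub0 sQ).
- exact: (subP sQ).
- by move=> v Qv; apply: two_pi_i_J0_sub.
- exact: hf.1.
- by move=> v Qv; apply: two_pi_i_J0_hom hf _.
Qed.

Lemma gen_vector_hom (M N : mode_space V) (Q : set M) (f : M -> N) lam k u :
  submodule Q -> hom_on Q f -> Q u -> gen_vector lam k u ->
  gen_vector lam k (f u).
Proof.
move=> sQ hf Qu g; rewrite /gen_vector.
have [_ <-] := @shift_iter_commute R M N Q (@two_pi_i_J0 M) (@two_pi_i_J0 N)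
  f lam k u (subP sQ) (fun v => two_pi_i_J0_sub sQ) hf.1
  (fun v => two_pi_i_J0_hom sQ hf) Qu.
by rewrite [shift_iter _ _ _ _]g; apply: hom_on0 hf.
Qed.

Lemma setT_submodule (M : mode_space V) : submodule (setT : set M).
Proof. by []. Qed.

Lemma shift_iter_two_pi_i M lam k (u : M) :
  shift_iter (@two_pi_i_J0 M) (two_pi_i R * lam) k u =
  two_pi_i R ^+ k *: shift_iter (J0 J (M := M)) lam k u.
Proof.
elim: k => [|k IH]; first by rewrite scale1r.
rewrite /shift_iter !iterS; move: IH; rewrite /shift_iter => ->.
rewrite /two_pi_i_J0 /J0 (linZ (act_linear M J 0)) exprS.
by rewrite !scalerBr !scalerA mulrAC.
Qed.

(** Since [monodromy] speaks about generalized eigenvectors only, statements about all vectors of a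
    submodule are reduced to them by linearity. *)
Lemma gen_vector_span M (S : set M) u : submodule S -> S u ->
  exists s : seq M, {in s, forall x, S x /\ exists lam k, gen_vector lam k x} /\
    u = \sum_(x <- s) x.
Proof.
move=> sS Su; have [s [hs ->]] := submodule_graded sS Su.
exists [seq x.2 | x <- s]; rewrite big_map; split=> // _ /mapP[x /hs[[[k hk] _] Sx] ->].
split=> //; exists (two_pi_i R * x.1.1), k.
by rewrite /gen_vector shift_iter_two_pi_i [shift_iter _ _ _ _]hk scaler0.
Qed.

Lemma gen_vector_eq M N (f g : M -> N) : linear f -> linear g ->
  (forall lam k u, gen_vector lam k u -> f u = g u) -> forall u, f u = g u.
Proof.
move=> lf lg e u.
have [s [hs ->]] := gen_vector_span (@setT_submodule M) (I : setT u).
rewrite !lin_sum //; apply: eq_big_seq => x /hs[_ [lam [k]]]; exact: e.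
Qed.

(** For a semisimple operator each generalized eigenvector is an eigenvector; its J_0-eigenvalue is
    h + n with n an integer, and exp(2 pi i n) = 1. *)
Lemma monodromy_semisimple M : J0_semisimple J M -> J0_eigenvalues_in J M h ->
  monodromy (fun _ : M => 0).
Proof.
move=> ss ev mu k v gv; rewrite addr0.
case: (eqVneq v 0) => [->|v0].
  by rewrite scaler0 lin0 //; apply/expsum_linear/two_pi_i_J0_linear.
have [s [hs es]] := ss v.
have [s' [hs' es']] : exists s' : seq (R[i] * M),
   {in s', forall x, two_pi_i_J0 x.2 = x.1 *: x.2} /\ v = \sum_(x <- s') x.2.
  rewrite es; elim: s hs {es} => [|x s IH] hs; first by exists [::]; rewrite !big_nil.
  have [|s' [hs' es']] := IH; first by move=> y ys; apply: hs; rewrite inE ys orbT.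
  have [lam hx] := hs x (mem_head _ _).
  exists ((two_pi_i R * lam, x) :: s'); rewrite !big_cons es'; split=> // y.
  rewrite inE => /orP[/eqP->|/hs' //] /=; rewrite /two_pi_i_J0.
  by rewrite [J0 _ _]hx scalerA.
have lD := two_pi_i_J0_linear M.
(* A projector that fixes [v] also deletes all terms of the eigenvector expansion of [v] except
   those of eigenvalue [mu]. *)
have [|p hp] := eigen_projector lD mu (s := (mu, v) :: s').
  move=> x; rewrite inE => /orP[/eqP->|/hs' ex]; first by exists k.
  by exists 1%N; rewrite shift_iter_eigen.
have ev' : v = \sum_(x <- s' | x.1 == mu) x.2.
  have := hp _ (mem_head _ _); rewrite eqxx /= {1}es' => <-.
  rewrite (lin_sum (pev_linear lD p)) [RHS]big_mkcond; apply: eq_big_seq => x xs.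
  by apply: hp; rewrite inE xs orbT.
have Dv : two_pi_i_J0 v = mu *: v.
  rewrite ev' (lin_sum lD) scaler_sumr big_seq_cond [RHS]big_seq_cond.
  by apply: eq_bigr => x /andP[/hs' -> /eqP ->].
rewrite expsum_eigen //; congr (_ *: _).
have [|n en] := ev ((two_pi_i R)^-1 * mu) v v0.
  by rewrite /op_eigenspace /= -scalerA -Dv scalerA mulVf ?scale1r // two_pi_i_neq0.
have -> : mu = two_pi_i R * (h + n%:~R) by rewrite -en mulVKf ?two_pi_i_neq0.
by rewrite mulrDr cexpD cexp_int_period mulr1.
Qed.

(** A vector is the sum of its parts in the images of [i] and of the section, and both maps commute
    with the exponential sum. *)
Lemma monodromy_split_extension M E N (i : M -> E) (p : E -> N) :
  short_exact i p -> split_extension i p -> monodromy (fun _ : M => 0) ->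
  monodromy (fun _ : N => 0) -> monodromy (fun _ : E => 0).
Proof.
move=> [hi hp injI surjp kerp] [s [hs ps]] mM mN lam k v gv.
have sT (X : mode_space V) := @setT_submodule X.
have gp := gen_vector_hom (sT E) (is_hom_on setT hp) I gv.
have gs := gen_vector_hom (sT N) (is_hom_on setT hs) I gp.
have es : expsum (@two_pi_i_J0 E) lam k (s (p v)) = c0 *: s (p v).
  have [_ <-] := expsum_hom lam k (sT N) (is_hom_on setT hs) (I : setT (p v)).
  by rewrite mN // addr0 (linZ hs.1).
have [m em] : exists m, i m = v - s (p v).
  by apply/kerp; rewrite (linB hp.1) ps subrr.
have gm : gen_vector lam k m.
  have gim : gen_vector lam k (i m).
    rewrite em /gen_vector (linB (shift_iter_linear (two_pi_i_J0_linear E) lam k)).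
    by rewrite [X in X - _]gv [X in _ - X]gs subrr.
  have [_] := @shift_iter_commute R M E setT (@two_pi_i_J0 M) (@two_pi_i_J0 E)
    i lam k m (subP (sT M)) (fun v => two_pi_i_J0_sub (sT M)) (is_hom_on setT hi).1
    (fun v => two_pi_i_J0_hom (sT M) (is_hom_on setT hi)) I.
  by rewrite [X in _ = X]gim -(lin0 hi.1) => /injI.
have ei : expsum (@two_pi_i_J0 E) lam k (i m) = c0 *: i m.
  have [_ <-] := expsum_hom lam k (sT M) (is_hom_on setT hi) (I : setT m).
  by rewrite mM // addr0 (linZ hi.1).
have lx := expsum_linear (two_pi_i_J0_linear E) lam k.
by rewrite addr0 -(subrK (s (p v)) v) -em (linD lx) ei es scalerDr.
Qed.

(** Applied to a pair [K], [Q] on which [pi] visibly does not map [Q] into [K], this refutes the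
    existence of the filtration with factors A and A. *)
Lemma selfextension_kills_pi (A M : gmodule J) (pi : M -> M) (K T Q : set M) :
  Ext1_zero A A -> monodromy (fun _ : A => 0) -> monodromy pi -> linear pi ->
  subquotient_iso K T A -> subquotient_iso T Q A -> forall u, Q u -> K (pi u).
Proof.
move=> extA mA mpi lpi iK iT u Qu.
have [sK sT KT _] := iK; have [_ sQ TQ _] := iT.
have KQ : K `<=` Q by move=> v /KT/TQ.
have [N /subquotient_isoP[_ _ _ [f [hf fs fk]]]] := subquotient_exists sK sQ KQ.
have lN := act_linear N; have refl (W : set M) : W `<=` W by [].
have := image_subquotient lN sQ hf fk (refl K) TQ iK.
rewrite (image_kernel sQ sK hf fk KQ) => iK'.
have := image_subquotient lN sQ hf fk KT (refl Q) iT.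
rewrite (image_full fs) => iT'.
have [i [p ex]] := short_exact_of_subquotients iK' iT'.
have mN := monodromy_split_extension ex (extA _ _ _ ex) mA mA.
have [s [hs ->]] := gen_vector_span sQ Qu.
rewrite (lin_sum lpi) big_seq; apply: (sub_sum sK) => x /hs[Qx [lam [k gx]]].
have [Qe fe] := expsum_hom lam k sQ hf Qx.
(* [pi] is assumed linear only, and no counterpart of it on [N] is given; on a generalized
   eigenvector it is recovered from the exponential sum, which [f] respects. *)
have ex' : pi x = c0^-1 *: expsum (@two_pi_i_J0 M) lam k x - x.
  by rewrite mpi // scalerA mulVf ?cexp_neq0 // scale1r addrAC subrr add0r.
have Qc : Q (c0^-1 *: expsum (@two_pi_i_J0 M) lam k x) by apply: (subZ sQ).
apply/fk; first by rewrite ex'; apply: (subB sQ).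
rewrite ex' (hom_onB sQ hf) // (hom_onZ sQ hf) // fe mN; last first.
  exact: gen_vector_hom hf _ _.
by rewrite addr0 scalerA mulVf ?cexp_neq0 // scale1r subrr.
Qed.

(** If no exponential existed, [opexp] would take its default value 0 and [pi_op] would be - Id; the
    hypothesis rules this out. *)
Lemma monodromy_pi_op M : (exists u : M, pi_op J h u <> - u) ->
  monodromy (@pi_op R V J h M).
Proof.
move=> [u0 hu0] lam k u gu; rewrite /pi_op addrC subrK.
rewrite scalerA -cexpD subrr cexp0 scale1r.
suff [_ hT] : is_opexp (@two_pi_i_J0 M) (opexp (@two_pi_i_J0 M)).
  by rewrite (hT _ _ _ gu).
have [ex|no] := pselect (exists T, is_opexp (@two_pi_i_J0 M) T).
  exact: (xgetPex _ ex).
case: hu0; rewrite /pi_op /opexp xgetPN ?scaler0 ?add0r // => T hT.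
by apply: no; exists T.
Qed.

End Monodromy.
Arguments two_pi_i_J0_linear {R V} J M.

Lemma submodule0 (R : realType) (V : voa R) (J : V) (M : gmodule J) :
  submodule [set 0 : M].
Proof.
split=> // [c u v -> ->|a n u ->]; first by rewrite scaler0 addr0.
by rewrite /= (lin0 (act_linear M a n)).
Qed.

(* The hypothesis only makes the kernel and the image of pi abstractly isomorphic;
   they coincide because pi vanishes on E, and E has no proper submodule isomorphic
   to itself. *)
Lemma pi_extension_square_zero (R : realType) (V : voa R) (J : V) (h : R[i])
    (M N E E2 : gmodule J) (i0 : M -> E) (q : E -> N) :
  simple_module M -> simple_module N -> ~ isomorphic M N ->
  monodromy J h (fun _ : M => 0) -> monodromy J h (fun _ : N => 0) ->
  short_exact i0 q -> ~ split_extension i0 q ->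
  nonsplit_pi_extension J h E E2 ->
  exists (j : E -> E2) (p : E2 -> E),
    short_exact j p /\ monodromy J h (fun x : E2 => j (p x)).
Proof.
move=> simM simN nMN mM mN ex ns [_ [i [p [j [exi _ hj jI pij]]]]].
have ar := nonsplit_arrow (act_linear E) ex ns.
have [isoM isoN _] := ar; have [sr _ _ _] := isoN.
have [hi0 hq i0I qs kq] := ex; have [hi hp iI ps kp] := exi.
have s0 := submodule0 E.
have zsub (W : set E) : submodule W -> [set 0] `<=` W by move=> sW _ ->; apply: sub0 sW.
have sall (X : mode_space V) := @setT_submodule _ V X.
(* Otherwise opexp is the default value 0 and pi = - Id is injective. *)
have nz : exists u : E2, pi_op J h u <> - u.
  apply: contrapT => no; have e (u : E2) : pi_op J h u = - u.
    by apply: contrapT => ne; apply: no; exists u.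
  have [[w w0] _] := simN; have [x xw] := qs w.
  have pix : p (i x) = 0 by apply/kp; exists x.
  have := e (i x); rewrite pij pix (lin0 hj.1) => /esym/eqP.
  rewrite oppr_eq0 -(lin0 hi.1) => /eqP /iI x0.
  by move: w0; rewrite -xw x0 (lin0 hq.1) eqxx.
have m2 : monodromy J h (fun x : E2 => j (p x)).
  by move=> lam k u gu; rewrite (monodromy_pi_op nz gu) pij.
(* Transported along the injection [j], the operator pi of [E2] becomes the endomorphism p j of
   [E]. *)
have mE : monodromy J h (fun x : E => p (j x)).
  move=> lam k u gu; apply: jI.
  have gj := gen_vector_hom (sall E) (is_hom_on setT hj) I gu.
  have [_ ->] := expsum_hom J lam k (sall E) (is_hom_on setT hj) (I : setT u).
  by rewrite m2 // (linZ hj.1) (linD hj.1).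
have c0n : cexp (two_pi_i R * h) != 0 by apply: cexp_neq0.
have cancel_c (X : gmodule J) (x y : X) :
    cexp (two_pi_i R * h) *: (x + y) = cexp (two_pi_i R * h) *: (x + 0) -> y = 0.
  by move/(scalerI c0n)/addrI.
have lH : linear (fun e => p (j e)) by move=> c u v; rewrite hj.1 hp.1.
have H0 m : p (j (i0 m)) = 0.
  have lHi : linear (fun m => p (j (i0 m))) by move=> c u v; rewrite hi0.1 lH.
  apply: (@gen_vector_eq _ _ _ M E _ (fun _ => 0) lHi) => [c u v|lam k u gu].
    by rewrite scaler0 addr0.
  have gi := gen_vector_hom (sall M) (is_hom_on setT hi0) I gu.
  have := mE _ _ _ gi.
  have [_ <-] := expsum_hom J lam k (sall M) (is_hom_on setT hi0) (I : setT u).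
  by rewrite mM // (linZ hi0.1) addr0 -[X in _ *: X = _]addr0 => /esym/cancel_c.
have qH e : q (p (j e)) = 0.
  have lqH : linear (fun e => q (p (j e))) by move=> c u v; rewrite lH hq.1.
  apply: (@gen_vector_eq _ _ _ E N _ (fun _ => 0) lqH) => [c u v|lam k u gu].
    by rewrite scaler0 addr0.
  have gq := gen_vector_hom (sall E) (is_hom_on setT hq) I gu.
  have := mN _ _ _ gq.
  have [_ <-] := expsum_hom J lam k (sall E) (is_hom_on setT hq) (I : setT u).
  by rewrite mE // (linZ hq.1) (linD hq.1) => /cancel_c.
(* The endomorphism p j kills [range i0] by [H0] and has values in it by [qH], so it induces a map
   from [N] to [M]. If nonzero, that map of simple modules would be an isomorphism. *)
have pj e : p (j e) = 0.
  have sker : submodule [set e | p (j e) = 0].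
    split=> [|c u v /= eu ev|a n u /= eu] /=.
    - by rewrite (lin0 lH).
    - by rewrite lH eu ev scaler0 addr0.
    - by rewrite hj.2 hp.2 eu (lin0 (act_linear E a n)).
  have simg : submodule (range (fun e => p (j e))).
    split=> [|c _ _ [u _ <-] [v _ <-]|a n _ [u _ <-]].
    - by exists 0 => //; rewrite (lin0 lH).
    - by exists (c *: u + v) => //; rewrite lH.
    - by exists (act E a n u) => //; rewrite hj.2 hp.2.
  have img_sub : range (fun e => p (j e)) `<=` range i0.
    by move=> _ [u _ <-]; have /kq[m em] := qH u; exists m.
  have [kr|all] := simple_subquotient simN isoN sker
    (fun _ => fun '(ex_intro2 m _ em) => etrans (congr1 (fun z => p (j z)) (esym em)) (H0 m))
    (fun _ _ => I); last by apply: all.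
  have [z|ri] := simple_subquotient simM isoM simg (zsub _ simg) img_sub.
    by apply: z; exists e.
  case: nMN; apply: (@isomorphic_of_corr _ _ M N
    [set x | exists e, p (j e) = i0 x.1 /\ q e = x.2]).
  - exact: act_linear.
  - split.
    + by exists 0; rewrite (lin0 lH) (lin0 hi0.1) (lin0 hq.1).
    + move=> c [a1 b1] [a2 b2] [u /= [u1 <-]] [v /= [v1 <-]].
      by exists (c *: u + v); rewrite lH hi0.1 hq.1 u1 v1.
    + move=> a n [a1 b1] [u /= [u1 <-]]; exists (act E a n u).
      by rewrite hj.2 hp.2 hi0.2 hq.2 u1.
  - move=> n [u /= [u1 <-]]; apply/kq.
    have [|m _ <-] := kr u; first by rewrite /= u1 (lin0 hi0.1).
    by exists m.
  - move=> m [u /= [u1 u2]]; apply: i0I; rewrite -u1 (lin0 hi0.1).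
    by have /kq[m' <-] := u2; apply: H0.
  - move=> n; have [u <-] := qs n; have /kq[m em] := qH u.
    by exists m, u.
  - move=> m; have [|u _ eu] := ri (i0 m); first by exists m.
    by exists (q u), u.
have jker e : exists e', i e' = j e by apply/kp.
exists j, p; split=> //; split=> // u; split=> [/kp[e <-]|[e <-]]; last exact: pj.
(* [Z] is j(E) seen inside i(E), hence a copy of [E]. If it were proper, it would lie in the simple
   submodule [range i0], which has no room for a module of length two; [Z1], the part coming from
   [M], makes this precise. *)
pose Z : set E := [set e | exists e', i e = j e'].
have sZ : submodule Z.
  split=> [|c u' v [a ea] [b eb]|a n u' [b eb]].
  - by exists 0; rewrite (lin0 hi.1) (lin0 hj.1).
  - by exists (c *: a + b); rewrite hi.1 hj.1 ea eb.
  - by exists (act E a n b); rewrite hi.2 hj.2 eb.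
have [[Zr|Zall] _] := arrow_uniserial (act_linear E) simN simM ar sZ (zsub _ sZ)
  (fun _ _ => I); last by have [e' ee] := Zall e I; exists e'.
pose Z1 : set E := [set e | exists m, i e = j (i0 m)].
have sZ1 : submodule Z1.
  split=> [|c u' v [a ea] [b eb]|a n u' [b eb]].
  - by exists 0; rewrite (lin0 hi.1) (lin0 hi0.1) (lin0 hj.1).
  - by exists (c *: a + b); rewrite hi.1 hi0.1 hj.1 ea eb.
  - by exists (act M a n b); rewrite hi.2 hi0.2 hj.2 eb.
have Z1r : Z1 `<=` range i0 by move=> x [m em]; apply: Zr; exists (i0 m).
have [z|rZ1] := simple_subquotient simM isoM sZ1 (zsub _ sZ1) Z1r.
  have [[m m0] _] := simM; have [x ex'] := jker (i0 m).
  have x0 : x = 0 by apply: z; exists m.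
  move: m0; rewrite (_ : m = 0) ?eqxx //; apply: i0I; apply: jI.
  by rewrite -ex' x0 (lin0 hi.1) (lin0 hi0.1) (lin0 hj.1).
case: (simple_subquotient_neq simN isoN) => x _.
have [y ey] := jker x; have [m em] := rZ1 y (Zr y (ex_intro _ x ey)).
by exists m => //; apply: jI; rewrite -em ey.
Qed.

(** * Gluing *)

Section Gluing.
Variables (R : realType) (V : voa R) (J : V) (h : R[i]).
Variables (A B C E F E2 F2 : gmodule J).
Variables (beta : B -> E) (q : E -> A) (iota : A -> F) (gamma : F -> C).
Variables (j1 : E -> E2) (p1 : E2 -> E) (j2 : F -> F2) (p2 : F2 -> F).
Hypotheses (exE : short_exact beta q) (exF : short_exact iota gamma).
Hypotheses (ex1 : short_exact j1 p1) (ex2 : short_exact j2 p2).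

Let hbeta : is_hom beta. Proof. by case: exE. Qed.
Let hq : is_hom q. Proof. by case: exE. Qed.
Let hiota : is_hom iota. Proof. by case: exF. Qed.
Let hgamma : is_hom gamma. Proof. by case: exF. Qed.
Let hj1 : is_hom j1. Proof. by case: ex1. Qed.
Let hp1 : is_hom p1. Proof. by case: ex1. Qed.
Let hj2 : is_hom j2. Proof. by case: ex2. Qed.
Let hp2 : is_hom p2. Proof. by case: ex2. Qed.
Let betaI : injective beta. Proof. by case: exE. Qed.
Let iotaI : injective iota. Proof. by case: exF. Qed.
Let j1I : injective j1. Proof. by case: ex1. Qed.
Let j2I : injective j2. Proof. by case: ex2. Qed.
Let qS w : exists u, q u = w. Proof. by case: exE. Qed.
Let gammaS w : exists u, gamma u = w. Proof. by case: exF. Qed.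
Let p1S w : exists u, p1 u = w. Proof. by case: ex1. Qed.
Let p2S w : exists u, p2 u = w. Proof. by case: ex2. Qed.
Let qK u : q u = 0 <-> exists b, beta b = u. Proof. by case: exE. Qed.
Let gammaK u : gamma u = 0 <-> exists b, iota b = u. Proof. by case: exF. Qed.
Let p1K u : p1 u = 0 <-> exists b, j1 b = u. Proof. by case: ex1. Qed.
Let p2K u : p2 u = 0 <-> exists b, j2 b = u. Proof. by case: ex2. Qed.

Let homP := (hbeta.1, hq.1, hiota.1, hgamma.1, hj1.1, hp1.1, hj2.1, hp2.1).
Let homA := (hbeta.2, hq.2, hiota.2, hgamma.2, hj1.2, hp1.2, hj2.2, hp2.2).
Let hom0 := (lin0 hbeta.1, lin0 hq.1, lin0 hiota.1, lin0 hgamma.1,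
             lin0 hj1.1, lin0 hp1.1, lin0 hj2.1, lin0 hp2.1).
Let homD := (linD hbeta.1, linD hq.1, linD hiota.1, linD hgamma.1,
             linD hj1.1, linD hp1.1, linD hj2.1, linD hp2.1).
Let homB := (linB hbeta.1, linB hq.1, linB hiota.1, linB hgamma.1,
             linB hj1.1, linB hp1.1, linB hj2.1, linB hp2.1).
Let homN := (linN hbeta.1, linN hq.1, linN hiota.1, linN hgamma.1,
             linN hj1.1, linN hp1.1, linN hj2.1, linN hp2.1).

Let act0 (X : gmodule J) a n : act X a n 0 = 0.
Proof. exact: (lin0 (act_linear X a n)). Qed.

Let qbeta b : q (beta b) = 0. Proof. by apply/qK; exists b. Qed.
Let p1j1 e : p1 (j1 e) = 0. Proof. by apply/p1K; exists e. Qed.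
Let p2j2 f : p2 (j2 f) = 0. Proof. by apply/p2K; exists f. Qed.

Let D : gmodule J := dsum_gmodule E2 F2.

(* P_A is glue_full / glue_ker; its radical and socle are the images of glue_rad
   and glue_soc, and glue_F / glue_ker is a copy of F. *)
Definition glue_full : set D := [set u | p2 u.2 = iota (q (p1 u.1))].
Definition glue_rad : set D := [set u | q (p1 u.1) = 0 /\ p2 u.2 = 0].
Definition glue_F : set D := [set u | p1 u.1 = 0 /\ p2 u.2 = 0].
Definition glue_X : set D :=
  [set u | q (p1 u.1) = 0 /\ exists a, u.2 = j2 (iota a)].
Definition glue_soc : set D :=
  [set u | p1 u.1 = 0 /\ exists a, u.2 = j2 (iota a)].
Definition glue_ker : set D :=
  [set u | exists e, u.1 = j1 e /\ u.2 = j2 (iota (q e))].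

Let lD := act_linear D.

Lemma glue_top : subquotient_iso glue_rad glue_full A.
Proof.
apply: (@subquotient_of_corr _ _ _ _
  [set x : dsum D A | q (p1 x.1.1) = x.2 /\ p2 x.1.2 = iota x.2]) => //.
- split.
  + by rewrite /= !hom0.
  + move=> c [[x y] a] [[x' y'] a'] /= [<- e] [<- e'].
    by rewrite !homP e e'.
  + by move=> b n [[x y] a] /= [<- e]; rewrite !homA e.
- by move=> n /= [<-]; rewrite !hom0.
- move=> a; have [e ea] := qS a; have [x xe] := p1S e; have [y ey] := p2S (iota a).
  by exists (x, y) => /=; rewrite xe ea ey.
- by move=> u; rewrite /glue_rad /= !hom0.
- by move=> u; split=> [e|[a [<- e]]] //; exists (q (p1 u.1)).
Qed.

Lemma glue_B : subquotient_iso glue_F glue_rad B.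
Proof.
apply: (@subquotient_of_corr _ _ _ _
  [set x : dsum D B | p1 x.1.1 = beta x.2 /\ p2 x.1.2 = 0]) => //.
- split.
  + by rewrite /= !hom0.
  + move=> c [[x y] a] [[x' y'] a'] /= [e1 e] [e1' e'].
    by rewrite !homP e e' e1 e1' scaler0 addr0.
  + by move=> b n [[x y] a] /= [e1 e]; rewrite !homA e e1 act0.
- by move=> n /= [e _]; apply: betaI; rewrite -e !hom0.
- move=> b; have [x xe] := p1S (beta b).
  by exists (x, 0) => /=; rewrite xe !hom0.
- by move=> u; rewrite /glue_F /= !hom0.
- move=> u; split=> [[/qK[b eb] e]|[b [/= e e']]]; first by exists b; rewrite /= eb.
  by split=> //; rewrite e.
Qed.

Lemma glue_C : subquotient_iso glue_X glue_rad C.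
Proof.
apply: (@subquotient_of_corr _ _ _ _ [set x : dsum D C | q (p1 x.1.1) = 0 /\
  exists f, x.1.2 = j2 f /\ gamma f = x.2]) => //.
- split.
  + by rewrite /= !hom0; split=> //; exists 0; rewrite !hom0.
  + move=> c [[x y] a] [[x' y'] a'] /= [e1 [f [-> <-]]] [e1' [f' [-> <-]]].
    rewrite !homP e1 e1' scaler0 addr0; split=> //.
    by exists (c *: f + f'); rewrite !homP.
  + move=> b n [[x y] a] /= [e1 [f [-> <-]]].
    by rewrite !homA e1 act0; split=> //; exists (act F b n f); rewrite !homA.
- move=> n /= [_ [f [e <-]]]; rewrite (_ : f = 0) ?hom0 //.
  by apply: j2I; rewrite -e hom0.
- move=> c; have [f fc] := gammaS c.
  by exists (0, j2 f) => /=; rewrite !hom0; split=> //; exists f.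
- move=> u; split=> [[e [a ea]]|[e [f [/= ef /gammaK[a ea]]]]].
    by split=> //; exists (iota a); split=> //; apply/gammaK; exists a.
  by split=> //; exists a; rewrite ea.
- move=> u; split=> [[e /p2K[f ef]]|[c [/= e [f [ef _]]]]].
    by exists (gamma f); split=> //; exists f.
  by split=> //; rewrite ef p2j2.
Qed.

(** The map to A sends (j1 e, j2 (iota a)) to q e - a, whose vanishing is the relation that defines
    [glue_ker]. *)
Lemma glue_bottom : subquotient_iso glue_ker glue_soc A.
Proof.
apply: (@subquotient_of_corr _ _ _ _ [set x : dsum D A |
  exists e, x.1.1 = j1 e /\ x.1.2 = j2 (iota (q e - x.2))]) => //.
- split.
  + by exists 0; rewrite /= subr0 !hom0.
  + move=> c [[x y] a] [[x' y'] a'] /= [e [-> ->]] [e' [-> ->]].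
    exists (c *: e + e'); rewrite hj1.1 -hj2.1 -hiota.1; split=> //.
    by rewrite hq.1 scalerBr addrACA -opprD.
  + move=> b n [[x y] a] /= [e [-> ->]]; exists (act E b n e).
    by rewrite hq.2 -(linB (act_linear A b n)) !homA.
- move=> n /= [e [/esym e1 e2]]; have e0 : e = 0 by apply: j1I; rewrite e1 hom0.
  by move: e2; rewrite e0 hom0 sub0r !homN => /esym/eqP; rewrite oppr_eq0 -!hom0 => /eqP/j2I/iotaI.
- by move=> a; exists (0, j2 (iota (- a))), 0; rewrite /= !hom0 sub0r.
- by move=> u; split=> -[e [e1 e2]]; exists e; move: e2; rewrite /= subr0.
- move=> u; split=> [[/p1K[e ee] [a ea]]|[a [e [/= e1 e2]]]].
    by exists (q e - a), e; rewrite /= subKr.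
  by split; [rewrite e1 p1j1|exists (q e - a)].
Qed.

Lemma glue_socB : subquotient_iso glue_soc glue_X B.
Proof.
apply: (@subquotient_of_corr _ _ _ _ [set x : dsum D B | p1 x.1.1 = beta x.2 /\
  exists a, x.1.2 = j2 (iota a)]) => //.
- split.
  + by rewrite /= !hom0; split=> //; exists 0; rewrite !hom0.
  + move=> c [[x y] a] [[x' y'] a'] /= [e1 [f ->]] [e1' [f' ->]].
    by rewrite !homP e1 e1'; split=> //; exists (c *: f + f'); rewrite !homP.
  + move=> b n [[x y] a] /= [e1 [f ->]].
    by rewrite !homA e1; split=> //; exists (act A b n f); rewrite !homA.
- by move=> n /= [e _]; apply: betaI; rewrite -e !hom0.
- move=> b; have [x xe] := p1S (beta b).
  by exists (x, 0) => /=; rewrite xe; split=> //; exists 0; rewrite !hom0.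
- by move=> u; rewrite /glue_soc /= !hom0.
- move=> u; split=> [[/qK[b eb] e]|[b [/= e e']]]; first by exists b; rewrite /= eb.
  by split=> //; rewrite e.
Qed.

Lemma glue_socC : subquotient_iso glue_soc glue_F C.
Proof.
apply: (@subquotient_of_corr _ _ _ _ [set x : dsum D C | p1 x.1.1 = 0 /\
  exists f, x.1.2 = j2 f /\ gamma f = x.2]) => //.
- split.
  + by rewrite /= !hom0; split=> //; exists 0; rewrite !hom0.
  + move=> c [[x y] a] [[x' y'] a'] /= [e1 [f [-> <-]]] [e1' [f' [-> <-]]].
    rewrite !homP e1 e1' scaler0 addr0; split=> //.
    by exists (c *: f + f'); rewrite !homP.
  + move=> b n [[x y] a] /= [e1 [f [-> <-]]].
    by rewrite !homA e1 act0; split=> //; exists (act F b n f); rewrite !homA.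
- move=> n /= [_ [f [e <-]]]; rewrite (_ : f = 0) ?hom0 //.
  by apply: j2I; rewrite -e hom0.
- move=> c; have [f fc] := gammaS c.
  by exists (0, j2 f) => /=; rewrite !hom0; split=> //; exists f.
- move=> u; split=> [[e [a ea]]|[e [f [/= ef /gammaK[a ea]]]]].
    by split=> //; exists (iota a); split=> //; apply/gammaK; exists a.
  by split=> //; exists a; rewrite ea.
- move=> u; split=> [[e /p2K[f ef]]|[c [/= e [f [ef _]]]]].
    by exists (gamma f); split=> //; exists f.
  by split=> //; rewrite ef p2j2.
Qed.

Hypotheses (nsE : ~ split_extension beta q) (nsF : ~ split_extension iota gamma).
Hypotheses (simA : simple_module A) (extA : Ext1_zero A A).
Hypothesis mA : monodromy J h (fun _ : A => 0).
Hypothesis m1 : monodromy J h (fun x : E2 => j1 (p1 x)).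
Hypothesis m2 : monodromy J h (fun x : F2 => j2 (p2 x)).

Let A_neq0 : exists a : A, a != 0. Proof. by case: simA. Qed.

(** Under u |-> p1 u.1 a complement would become a complement of B in E. *)
Lemma glue_arrow_topB : arrow glue_F glue_rad glue_full A B.
Proof.
split; [exact: glue_B|exact: glue_top|move=> [W [sW WQ WT WQT]]].
have [_ _] := nonsplit_arrow (act_linear E) exE nsE; apply.
exists [set e | exists2 u, W u & p1 u.1 = e]; split=> //.
- split.
  + by exists 0; [apply: (sub0 sW)|rewrite hom0].
  + move=> c _ _ [u Wu <-] [v Wv <-]; exists (c *: u + v); first exact: (subP sW).
    by rewrite -hp1.1.
  + move=> b n _ [u Wu <-]; exists (act D b n u); first exact: (subact sW).
    by rewrite -hp1.2.
- apply/seteqP; split=> [e [[u Wu eu] [b _ eb]]|_ ->]; last first.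
    split; first by exists 0; [apply: (sub0 sW)|rewrite hom0].
    by exists 0; rewrite // hom0.
  have qe : q (p1 u.1) = 0 by rewrite eu -eb qbeta.
  have : (W `&` glue_rad) u by split=> //; split=> //; rewrite (WQ u Wu) qe hom0.
  by rewrite WT => -[p0 _]; rewrite -eu p0.
- move=> e _; have [x xe] := p1S e; have [y ye] := p2S (iota (q e)).
  have [|[x1 y1] [[x2 y2] [Ww [/= /qK[b eb] _] exy]]] := WQT (x, y).
    by rewrite /glue_full /= xe ye.
  exists (p1 x1), (beta b); split; first by exists (x1, y1).
    by exists b.
  by case: exy => ex _; rewrite eb -homD -xe ex.
Qed.

(** Under f |-> (0, j2 f) a complement would pull back to a complement of A in F. *)
Lemma glue_arrow_Cbottom : arrow glue_ker glue_soc glue_F C A.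
Proof.
split; [exact: glue_bottom|exact: glue_socC|move=> [W [sW WF WS WFS]]].
have KW : glue_ker `<=` W by rewrite -WS => u [].
have [_ _] := nonsplit_arrow (act_linear F) exF nsF; apply.
exists [set f | W ((0, j2 f) : D)]; split=> //.
- split.
  + by rewrite /= hom0; apply: (sub0 sW).
  + move=> c u v /= Wu Wv; have := subP sW c Wu Wv.
    congr W; apply: injective_projections; rewrite /= ?homP //.
    by rewrite scaler0 addr0.
  + move=> b n u /= Wu; have := subact sW b n Wu.
    by congr W; apply: injective_projections; rewrite /= ?homA // act0.
- apply/seteqP; split=> [f [/= Wf [a _ ea]]|_ ->]; last first.
    split; first by rewrite /= hom0; apply: (sub0 sW).
    by exists 0; rewrite // hom0.
  have : (W `&` glue_soc) (0, j2 f).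
    by split=> //; split; rewrite /= ?hom0 //; exists a; rewrite ea.
  rewrite WS => -[e [/= e1 /j2I ->]].
  by rewrite (_ : e = 0) ?hom0 //; apply: j1I; rewrite -e1 hom0.
- move=> f _.
  have [|[x1 y1] [[x2 y2] [Ww [/= /p1K[e ee] [a ea]] exy]]] := WFS (0, j2 f).
    by rewrite /glue_F /= hom0 p2j2.
  have [ex ey] : 0 = x1 + x2 /\ j2 f = y1 + y2 by case: exy.
  (* The element of [W] at hand has first coordinate - j1 e; adding the element of [glue_ker] given
     by [e] clears it. *)
  exists (f - iota a + iota (q e)), (iota (a - q e)); split.
  + have Kk : W (j1 e, j2 (iota (q e))) by apply: KW; exists e.
    have := subD sW Ww Kk; congr W; apply: injective_projections => /=.
      by rewrite ex ee.
    by rewrite !homD homN ey ea addrK.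
  + by exists (a - q e).
  + by rewrite homB addrACA subrK subrr addr0.
Qed.

(** A complement [W] makes T1 / W1 a copy of A, through the a with (x, j2 (iota a)) in [W], while E2
    / T1 is A anyway. So pi(E2) = j1(E) lies in [W1], and (j1 e, 0) lies in both [W] and [glue_soc],
    hence in [glue_ker]; this forces q e = 0 for every e. *)
Lemma glue_arrow_Bbottom : arrow glue_ker glue_soc glue_X B A.
Proof.
split; [exact: glue_bottom|exact: glue_socB|move=> [W [sW WX WS WXS]]].
have KW : glue_ker `<=` W by rewrite -WS => u [].
pose T1 : set E2 := [set x | q (p1 x) = 0].
pose W1 : set E2 := [set x | W ((x, 0) : D)].
have iW : subquotient_iso W1 T1 A.
  apply: (@subquotient_of_corr _ _ _ _
    [set x : dsum E2 A | W ((x.1, j2 (iota x.2)) : D)]) => //.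
  - exact: act_linear.
  - split.
    + by rewrite /= !hom0; apply: (sub0 sW).
    + move=> c [x a] [x' a'] /= Wu Wv; have := subP sW c Wu Wv.
      by congr W; apply: injective_projections; rewrite /= ?homP.
    + move=> b n [x a] /= Wu; have := subact sW b n Wu.
      by congr W; apply: injective_projections; rewrite /= ?homA.
  - move=> a /= Wa; have : (W `&` glue_soc) (0, j2 (iota a)).
      by split=> //; split; rewrite /= ?hom0 //; exists a.
    rewrite WS => -[e [/= e1 /j2I /iotaI ->]].
    by rewrite (_ : e = 0) ?hom0 //; apply: j1I; rewrite -e1 hom0.
  - by move=> a; have [e <-] := qS a; exists (j1 e); apply: KW; exists e.
  - by move=> x; rewrite /W1 /= !hom0.
  - move=> x; split=> [qx|[a /= /WX[]] //].
    have [|[x1 y1] [[x2 y2] [Ww [/= /p1K[e ee] [a ea]] exy]]] := WXS (x, 0).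
      by split=> //; exists 0; rewrite !hom0.
    have [ex ey] : x = x1 + x2 /\ 0 = y1 + y2 by case: exy.
    exists (q e - a).
    have Kk : W (j1 e, j2 (iota (q e))) by apply: KW; exists e.
    have := subD sW Ww Kk; congr W; apply: injective_projections => /=.
      by rewrite ex ee.
    by rewrite !homB addrC -[in RHS]ea; congr (_ + _); apply/eqP; rewrite -subr_eq0 opprK ey.
have iT : subquotient_iso T1 setT A.
  apply: (@subquotient_of_corr _ _ _ _ [set x : dsum E2 A | q (p1 x.1) = x.2]) => //.
  - exact: act_linear.
  - split.
    + by rewrite /= !hom0.
    + by move=> c [x a] [x' a'] /= <- <-; rewrite !homP.
    + by move=> b n [x a] /= <-; rewrite !homA.
  - by move=> a /= <-; rewrite !hom0.
  - by move=> a; have [e <-] := qS a; have [x <-] := p1S e; exists x.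
  - by move=> x; split=> // _; exists (q (p1 x)).
have lpi : linear (fun x => j1 (p1 x)) by move=> c u v; rewrite !homP.
have kill := selfextension_kills_pi extA mA m1 lpi iW iT.
have [a a0] := A_neq0; have [e ea] := qS a; have [x xe] := p1S e.
have Wx : W1 (j1 e) by rewrite -xe; apply: kill.
have : (W `&` glue_soc) (j1 e, 0).
  by split=> //; split; rewrite /= ?p1j1 //; exists 0; rewrite !hom0.
rewrite WS => -[e' [/= /j1I <-]]; rewrite ea -(lin0 hj2.1) => /j2I.
rewrite -(lin0 hiota.1) => /iotaI a00.
by rewrite -a00 eqxx in a0.
Qed.

(** A complement [W] projects to a submodule [W1] of F2 that is an extension of A by T1 = A. So pi
    vanishes on [W1], that is, p2 y = 0 there; this puts [W] inside [glue_rad], hence [W1] inside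
    [T1], leaving no room for the upper A. *)
Lemma glue_arrow_topC : arrow glue_X glue_rad glue_full A C.
Proof.
split; [exact: glue_C|exact: glue_top|move=> [W [sW WQ WT WQT]]].
have XW : glue_X `<=` W by rewrite -WT => u [].
pose T1 : set F2 := [set y | exists a, y = j2 (iota a)].
pose W1 : set F2 := [set y | exists x, W ((x, y) : D)].
have iT : subquotient_iso [set 0] T1 A.
  apply: (@subquotient_of_corr _ _ _ _ [set x : dsum F2 A | x.1 = j2 (iota x.2)]) => //.
  - exact: act_linear.
  - split.
    + by rewrite /= !hom0.
    + by move=> c [x a] [x' a'] /= -> ->; rewrite !homP.
    + by move=> b n [x a] /= ->; rewrite !homA.
  - by move=> a /=; rewrite -!hom0 => /j2I /iotaI <-.
  - by move=> a; exists (j2 (iota a)).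
  - by move=> y /=; rewrite !hom0.
have iW : subquotient_iso T1 W1 A.
  apply: (@subquotient_of_corr _ _ _ _
    [set x : dsum F2 A | W1 x.1 /\ p2 x.1 = iota x.2]) => //.
  - exact: act_linear.
  - split.
    + by rewrite /= !hom0; split=> //; exists 0; apply: (sub0 sW).
    + move=> c [y a] [y' a'] /= [[x Wx] e] [[x' Wx'] e']; rewrite !homP e e'.
      by split=> //; exists (c *: x + x'); apply: (subP sW c Wx Wx').
    + move=> b n [y a] /= [[x Wx] e]; rewrite !homA e.
      by split=> //; exists (act E2 b n x); apply: (subact sW b n Wx).
  - by move=> a /= [_]; rewrite hom0 -hom0 => /iotaI <-.
  - move=> a; have [e ea] := qS a; have [x xe] := p1S e; have [y ye] := p2S (iota a).
    have [|[x1 y1] [[x2 y2] [Ww [/= _ p2y] exy]]] := WQT (x, y).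
      by rewrite /glue_full /= xe ea ye.
    have ey : y = y1 + y2 by case: exy.
    by exists y1; split; [exists x1|rewrite /= -ye ey homD p2y addr0].
  - move=> y; split=> [[a ->]|[[x Wx] /=]].
      split; last by rewrite /= p2j2 hom0.
      by exists 0; apply: XW; split; rewrite /= ?hom0 //; exists a.
    rewrite hom0 => e; suff : (W `&` glue_rad) (x, y) by rewrite WT => -[].
    split=> //; split=> //=; apply: iotaI; rewrite -(WQ _ Wx) hom0; exact: e.
  - move=> y; split=> [[x Wx]|[a []//]].
    by exists (q (p1 x)); split; [exists x|apply: (WQ _ Wx)].
have lpi : linear (fun x => j2 (p2 x)) by move=> c u v; rewrite !homP.
have kill := selfextension_kills_pi extA mA m2 lpi iT iW.
have /subquotient_isoP[_ _ _ [g [hg gs gk]]] := iW.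
apply: (simple_subquotient_neq simA iW) => y Wy.
have : j2 (p2 y) = 0 by apply: kill.
rewrite -hom0 => /j2I p2y; have [x Wx] := Wy.
suff : (W `&` glue_rad) (x, y) by rewrite WT => -[].
by split=> //; split=> //=; apply: iotaI; rewrite -(WQ _ Wx) hom0.
Qed.

Lemma glue_pi_sub u : glue_full u -> glue_ker (j1 (p1 u.1), j2 (p2 u.2)).
Proof. by move=> Qu; exists (p1 u.1); split; rewrite //= Qu. Qed.

Lemma glue_monodromy :
  monodromy J h (fun u : D => (j1 (p1 u.1), j2 (p2 u.2)) : D).
Proof.
move=> lam k u gu; have sT := @setT_submodule _ _ D.
have h1 : is_hom (fun u : D => u.1 : E2) by split.
have h2 : is_hom (fun u : D => u.2 : F2) by split.
have g1 := gen_vector_hom sT (is_hom_on setT h1) I gu.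
have g2 := gen_vector_hom sT (is_hom_on setT h2) I gu.
apply: injective_projections.
  by have [_ ->] := expsum_hom J lam k sT (is_hom_on setT h1) (I : setT u); apply: m1.
by have [_ ->] := expsum_hom J lam k sT (is_hom_on setT h2) (I : setT u); apply: m2.
Qed.

Lemma glued_module (simB : simple_module B) (simC : simple_module C)
    (nBC : ~ isomorphic B C) :
  exists P : gmodule J,
    [/\ indecomposable P, J0_semisimple J P & loewy_diamond P A B C A].
Proof.
have [sK sS KS _] := glue_bottom; have [_ sF SF _] := glue_socC.
have [_ sX SX _] := glue_socB; have [_ sT FT _] := glue_B.
have [_ _ XT _] := glue_C; have [_ sQ TQ _] := glue_top.
have KQ : glue_ker `<=` glue_full by move=> u /KS/SF/FT/TQ.
have [P /subquotient_isoP[_ _ _ [f [hf fs fk]]]] := subquotient_exists sK sQ KQ.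
have KF : glue_ker `<=` glue_F by move=> u /KS/SF.
have KX : glue_ker `<=` glue_X by move=> u /KS/SX.
have FQ : glue_F `<=` glue_full by move=> u /FT/TQ.
have XQ : glue_X `<=` glue_full by move=> u /XT/TQ.
have refl (W : set D) : W `<=` W by [].
have lP := act_linear P.
have := image_arrow lP sQ hf fk KF (refl _) glue_arrow_topB.
rewrite (image_full fs) => a1.
have := image_arrow lP sQ hf fk KX (refl _) glue_arrow_topC.
rewrite (image_full fs) => a2.
have := image_arrow lP sQ hf fk (refl _) XQ glue_arrow_Bbottom.
rewrite (image_kernel sQ sK hf fk KQ) => a3.
have := image_arrow lP sQ hf fk (refl _) FQ glue_arrow_Cbottom.
rewrite (image_kernel sQ sK hf fk KQ) => a4.
have FXS : f @` glue_F `&` f @` glue_X `<=` f @` glue_soc.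
  move=> v [[u Fu eu] Xv]; exists u => //.
  have [_ [a ea]] : glue_X u.
    by apply/(image_memE sQ hf fk sX KX XQ (FQ _ Fu)); rewrite eu.
  by case: Fu => p0 _; split=> //; exists a.
have FXT : f @` glue_rad `<=` sub_add (f @` glue_F) (f @` glue_X).
  move=> _ [[x y] [/= qx py] <-].
  have F0 : glue_F (0, y) by rewrite /glue_F /= hom0.
  have X0 : glue_X (x, 0) by split=> //; exists 0; rewrite !hom0.
  exists (f (0, y)), (f (x, 0)); split; [by exists (0, y)|by exists (x, 0)|].
  rewrite -(hom_onD hf); [|exact: FQ|exact: XQ].
  by congr f; apply: injective_projections; rewrite /= ?addr0 ?add0r.
exists P; split.
- exact: (diamond_indecomposable lP (act_linear B) simA simB simC nBC a1 a2 a3 a4).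
- move=> v; have [u Qu <-] := fs v; have [s [hs ->]] := gen_vector_span sQ Qu.
  exists [seq f x | x <- s]; split; last first.
    by rewrite big_map big_seq (hom_on_sum sQ hf) -?big_seq // => x /hs[].
  move=> _ /mapP[x /hs[Qx [lam [k gx]]] ->].
  exists ((two_pi_i R)^-1 * lam).
  (* Since pi maps [x] into [glue_ker], the exponential acts on [f x] as the scalar e^(2 pi i h),
     which a generalized eigenvector allows only if it is an eigenvector. *)
  have e : two_pi_i_J0 J (f x) = lam *: f x.
    have gfx := gen_vector_hom sQ hf Qx gx.
    apply: (eigen_of_scalar_expsum (two_pi_i_J0_linear J P) gfx
      (c := cexp (two_pi_i R * h))).
    have [_ <-] := expsum_hom J lam k sQ hf Qx.
    have Kx := glue_pi_sub Qx.
    rewrite glue_monodromy // (hom_onZ sQ hf); last by apply: (subD sQ) => //; apply: KQ.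
    rewrite (hom_onD hf) //; last exact: KQ.
    by rewrite (fk _ (KQ _ Kx)).2 ?addr0.
  by rewrite /op_eigenspace /= -scalerA -e scalerA mulVf ?scale1r // two_pi_i_neq0.
- exact: (diamond_loewy lP (act_linear B) simA simB simC nBC FXS FXT a1 a2 a3 a4).
Qed.

End Gluing.

(** Used contrapositively: as E_B and F_C are non-split, A is isomorphic neither to B nor to C. *)
Lemma selfextension_split (R : realType) (V : voa R) (J : V) (M N E : gmodule J)
    (i : M -> E) (p : E -> N) : Ext1_zero N N -> short_exact i p ->
  isomorphic N M -> split_extension i p.
Proof.
move=> extN [hi hp iI ps kp] [phi [[lphi aphi] [psi phiK psiK]]].
apply: (extN E (i \o phi) p); split=> //.
- by split=> [c u v|a n u] /=; rewrite ?lphi ?aphi ?hi.1 ?hi.2.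
- by move=> x y /= /iI /(can_inj phiK).
- move=> u; split=> [/kp[m <-]|[n <-]]; last by apply/kp; exists (phi n).
  by exists (psi m); rewrite /= psiK.
Qed.

Theorem theoremA1 (R : realType) (V : voa R) (J : V) (HJ : heisenberg J)
  (A B C : gmodule J) (h : R[i])
  (sA : simple_module A) (sB : simple_module B) (sC : simple_module C)
  (nBC : ~ isomorphic B C)
  (ssA : J0_semisimple J A) (ssB : J0_semisimple J B) (ssC : J0_semisimple J C)
  (evA : J0_eigenvalues_in J A h) (evB : J0_eigenvalues_in J B h)
  (evC : J0_eigenvalues_in J C h)
  (extA : Ext1_zero A A) (extB : Ext1_zero B B) (extC : Ext1_zero C C)
  (EB FC : gmodule J)
  (hEB : nonsplit_extension B EB A) (hFC : nonsplit_extension A FC C)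
  (EB2 FC2 : gmodule J)
  (hEB2 : nonsplit_pi_extension J h EB EB2)
  (hFC2 : nonsplit_pi_extension J h FC FC2) :
  exists P : gmodule J,
    [/\ indecomposable P, J0_semisimple J P & loewy_diamond P A B C A].
Proof.
have [beta [q [exE nsE]]] := hEB; have [iota [gamma [exF nsF]]] := hFC.
have mA := monodromy_semisimple ssA evA.
have mB := monodromy_semisimple ssB evB.
have mC := monodromy_semisimple ssC evC.
have nBA : ~ isomorphic B A.
  by move=> /isomorphic_sym iso; apply: nsE; apply: selfextension_split iso.
have nAC : ~ isomorphic A C.
  by move=> /isomorphic_sym iso; apply: nsF; apply: selfextension_split iso.
have [j1 [p1 [ex1 m1]]] := pi_extension_square_zero sB sA nBA mB mA exE nsE hEB2.
have [j2 [p2 [ex2 m2]]] := pi_extension_square_zero sA sC nAC mA mC exF nsF hFC2.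
exact: (glued_module exE exF ex1 ex2 nsE nsF sA extA mA m1 m2 sB sC nBC).
Qed.
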